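(* Let $\mathbb{F}$ be an arbitrary field (finite or infinite), $G$ an arbitrary group, and let $\varepsilon:\mathbb{N}\to G$ define a $G$-grading on $\mathrm{UT}$ via $\deg_G e_{i,i+1}=\varepsilon(i)$. Then: (i) $\mathrm{Id}_G(\mathrm{UT},\varepsilon)$ is generated, as an ideal of graded polynomial identities, by all polynomials $f_\eta=f_1\cdots f_m$, where $\eta=(\deg_G f_1,\ldots,\deg_G f_m)$ is an $\varepsilon$-bad sequence and each $f_i$ has one of the following forms: $f_i=z_i$ (a variable of nontrivial degree); $f_i=[y_{2i},y_{2i+1}]$; or, only if $\mathbb{F}$ is a finite field with $q$ elements, $f_i=y_{2i}^q-y_{2i}$. (ii) A vector space basis of the relatively free $G$-graded algebra $\mathbb{F}\langle X^G\rangle/\mathrm{Id}_G(\mathrm{UT},\varepsilon)$ consists of (the images of) the polynomials $$f=y_1^{a_1}\cdots y_s^{a_s}c_1\cdots c_m,$$ where $s,m\ge 0$, $0\le a_1,\ldots,a_s<|\mathbb{F}|$ (i.e. the $a_i$ are arbitrary non-negative integers if $\mathbb{F}$ is infinite), the sequence $(\deg_G c_1,\ldots,\deg_G c_m)$ is $\varepsilon$-good, and each $c_i$ is: (a) a semistandard commutator, if $\mathbb{F}$ is infinite; (b) an L-normal polynomial, if $\mathbb{F}$ is finite with $q$ elements.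
   Context: $\mathbb{N}=\{1,2,\ldots\}$. $\mathrm{UT}$ is the associative $\mathbb{F}$-algebra with basis $\{e_{ij}\mid 1\le i\le j\}$ ($i,j\in\mathbb{N}$) and product $e_{ij}e_{k\ell}=\delta_{jk}e_{i\ell}$; the $e_{ij}$ are the matrix units, and its Jacobson radical is $J(\mathrm{UT})=\mathrm{Span}\{e_{ij}\mid i<j\}$. A map $\varepsilon:\mathbb{N}\to G$ defines a $G$-grading on $\mathrm{UT}$ in which each $e_{ij}$ is homogeneous of degree $\varepsilon(i)\varepsilon(i+1)\cdots\varepsilon(j-1)$ (so $\deg_G e_{ii}=1$). A finite sequence $\eta=(\eta_1,\ldots,\eta_m)$, $m\ge0$, of elements of $G$ is $\varepsilon$-good if there are matrix units $r_1,\ldots,r_m\in J(\mathrm{UT})$ with $r_1\cdots r_m\ne0$ and $\deg_G r_i=\eta_i$ for all $i$; otherwise it is $\varepsilon$-bad. The empty sequence is $\varepsilon$-good. $\mathbb{F}\langle X^G\rangle$ is the free associative unital algebra on variables $x_i^{(g)}$ ($g\in G$, $i\in\mathbb{N}$), graded by $\deg_G x_i^{(g)}=g$. Variables of degree $1$ are denoted $y_i=x_i^{(1)}$ (even variables); the letter $z$ denotes variables of nontrivial degree (odd variables). For a $G$-graded algebra $\mathcal{A}$, $f(x_1^{(g_1)},\ldots,x_m^{(g_m)})$ is a graded polynomial identity of $\mathcal{A}$ if $f(a_1,\ldots,a_m)=0$ for all $a_i\in\mathcal{A}_{g_i}$ (constant terms are evaluated in the unitization of $\mathcal{A}$, so graded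 identities have zero constant term); $\mathrm{Id}_G(\mathcal{A})$ is the set of these, and $\mathrm{Id}_G(\mathrm{UT},\varepsilon)$ is that of $\mathrm{UT}$ with the grading defined by $\varepsilon$. The ideal of graded polynomial identities generated by a set is the smallest two-sided ideal containing it and invariant under all degree-preserving algebra endomorphisms of $\mathbb{F}\langle X^G\rangle$. Commutators are left-normed: $[a,b]=ab-ba$, $[a_1,\ldots,a_n]=[[a_1,\ldots,a_{n-1}],a_n]$, and $[a_1]=a_1$. A semistandard commutator is a polynomial of one of the forms $[z,y_{i_2},\ldots,y_{i_s}]$ with $s\ge1$, $z$ an odd variable, $i_2\le\cdots\le i_s$; or $[y_{i_1},y_{i_2},\ldots,y_{i_s}]$ with $s\ge2$, $i_1>i_2\le i_3\le\cdots\le i_s$. If $|\mathbb{F}|=q<\infty$, an L-normal polynomial is a polynomial of one of the forms: (1) a semistandard commutator $[z,y_{i_2},\ldots,y_{i_s}]$ starting with an odd variable, in which each even variable occurs at most $q-1$ times; (2) a semistandard commutator $[y_{i_1},\ldots,y_{i_s}]$ ($s\ge2$, $i_1>i_2\le\cdots\le i_s$) in which each variable occurs at most $q-1$ times in total (counting the first position); (3) $[y_{i_1}^q-y_{i_1},y_{i_2},\ldots,y_{i_s}]$ with $s\ge1$, $i_2\le\cdots\le i_s$, $i_1\notin\{i_2,\ldots,i_s\}$, and each of the variables $y_{i_2},\ldots,y_{i_s}$ occurring at most $q-1$ times. *)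

(* Defs.v *)
From HB Require Import structures.
From mathcomp Require Import all_boot all_algebra generic_quotient ring_quotient.
From mathcomp Require Import finmap.
From mathcomp.multinomials Require Import monalg.
From mathcomp Require Import boolp classical_sets functions cardinality.

Set Implicit Arguments.
Unset Strict Implicit.
Unset Printing Implicit Defensive.

Import GRing.Theory.

Local Open Scope quotient_scope.
Local Open Scope ring_scope.

Section LinearExtension.
Variables (F : fieldType) (K : choiceType) (V : lmodType F).
Implicit Types (h : K -> V) (u v : {malg F[K]}).

Definition lin_ext h u : V := \sum_(k <- msupp u) u@_k *: h k.

Lemma lin_extEw h u (d : {fset K}) : (msupp u `<=` d)%fset ->
  lin_ext h u = \sum_(k <- d) u@_k *: h k.
Proof.
move=> le; rewrite /lin_ext (big_fset_incl _ le) //= => k _ kN.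
by rewrite mcoeff_outdom // scale0r.
Qed.

Lemma lin_ext_is_linear h : linear (lin_ext h).
Proof.
move=> a u v; pose d := (msupp u `|` msupp v `|` msupp (a *: u + v))%fset.
rewrite !(@lin_extEw h _ d); try by
  apply/fsubsetP=> k kin; rewrite !inE kin ?orbT.
rewrite scaler_sumr -big_split; apply: eq_bigr => k _ /=.
by rewrite mcoeffD mcoeffZ scalerDl scalerA.
Qed.

HB.instance Definition _ h :=
  GRing.isLinear.Build F {malg F[K]} V _ (lin_ext h) (lin_ext_is_linear h).

Lemma lin_extU h k : lin_ext h << k >> = h k.
Proof. by rewrite (lin_extEw h msuppU_le) big_seq_fset1 mcoeffUU scale1r. Qed.

Lemma eq_lin_ext h1 h2 : h1 =1 h2 -> lin_ext h1 =1 lin_ext h2.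
Proof. by move=> eh u; apply: eq_bigr => k _; rewrite eh. Qed.

Lemma malg_expand u : u = \sum_(k <- msupp u) u@_k *: << k >>.
Proof.
apply/malgP => j; rewrite [in LHS](monalgE u) !raddf_sum /=.
by apply: eq_bigr => k _; rewrite mcoeffZ !mcoeffU mulr_natr.
Qed.

Lemma eq_linear_malg (f g : {linear {malg F[K]} -> V}) :
  (forall k, f << k >> = g << k >>) -> f =1 g.
Proof.
move=> e u; rewrite (malg_expand u) !linear_sum; apply: eq_bigr => k _.
by rewrite !linearZ /= e.
Qed.

End LinearExtension.

(* The rows and columns are indexed by nat = {0, 1, ...} instead of          *)
(* {1, 2, ...}; the matrix unit (i, j) stands for e_{i+1,j+1}.               *)
Definition matrix_unit := {ij : nat * nat | (ij.1 <= ij.2)%N}.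

HB.instance Definition _ := Choice.on matrix_unit.

Definition UT (F : fieldType) := {malg F[matrix_unit]}.

HB.instance Definition _ (F : fieldType) := GRing.Lmodule.on (UT F).

(* Locked because unifying << k >> and << l >> for distinct k and l unfolds  *)
(* the construction of finitely supported functions.                         *)
HB.lock Definition munit (F : fieldType) (k : matrix_unit) : UT F := << k >>.

(* e_ij, with the junk value 0 when j < i.                                   *)
Definition munit_at (F : fieldType) (i j : nat) : UT F :=
  oapp (munit F) 0 (insub (i, j)).

Definition munit_mul (F : fieldType) (k l : matrix_unit) : UT F :=
  if (val k).2 == (val l).1 then munit_at F (val k).1 (val l).2 else 0.

HB.lock Definition ut_mul (F : fieldType) (u v : UT F) : UT F :=
  lin_ext (fun k => lin_ext (munit_mul F k) v) u.
Arguments ut_mul {F} u v.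

Section UTProduct.
Variable F : fieldType.
Implicit Types (k l m : matrix_unit) (u v w : UT F).
Local Notation E := (munit F).
Local Notation e := (munit_at F).

Definition ut_mulr v u : UT F := ut_mul u v.

Lemma ut_mulr_is_linear v : linear (ut_mulr v).
Proof. by move=> a u u'; rewrite /ut_mulr ut_mul.unlock linearP. Qed.

Lemma ut_mul_is_linear u : linear (ut_mul u).
Proof.
move=> a v v'; rewrite ut_mul.unlock /lin_ext scaler_sumr -big_split /=.
apply: eq_bigr => k _; rewrite -!/(lin_ext _ _) linearP scalerDr !scalerA.
by rewrite mulrC.
Qed.

HB.instance Definition _ v :=
  GRing.isLinear.Build F (UT F) (UT F) _ (ut_mulr v) (ut_mulr_is_linear v).
HB.instance Definition _ u :=
  GRing.isLinear.Build F (UT F) (UT F) _ (ut_mul u) (ut_mul_is_linear u).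

Lemma eq_linear_ut (f g : {linear UT F -> UT F}) :
  (forall k, f (E k) = g (E k)) -> f =1 g.
Proof. by rewrite munit.unlock; apply: eq_linear_malg. Qed.

Lemma ut_mulEE k l : ut_mul (E k) (E l) = munit_mul F k l.
Proof. by rewrite ut_mul.unlock munit.unlock !lin_extU. Qed.

Lemma munit_at_val k : e (val k).1 (val k).2 = E k.
Proof. by rewrite /munit_at -surjective_pairing valK. Qed.

Lemma ut_mul_at (i j k l : nat) : (i <= j)%N -> (k <= l)%N ->
  ut_mul (e i j) (e k l) = if j == k then e i l else 0.
Proof.
move=> le1 le2; pose p : matrix_unit := exist _ (i, j) le1.
pose q : matrix_unit := exist _ (k, l) le2.
by rewrite (munit_at_val p) (munit_at_val q) ut_mulEE.
Qed.

Lemma ut_mulEEE k l m :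
  ut_mul (ut_mul (E k) (E l)) (E m) = ut_mul (E k) (ut_mul (E l) (E m)).
Proof.
rewrite -!munit_at_val.
case: k l m => [[i1 j1] /= le1] [[i2 j2] /= le2] [[i3 j3] /= le3].
rewrite (ut_mul_at le1 le2) (ut_mul_at le2 le3).
have [e1|n1] := eqVneq j1 i2; have [e2|n2] := eqVneq j2 i3.
- have le12 : (i1 <= j2)%N by rewrite (leq_trans le1) // e1.
  have le23 : (i2 <= j3)%N by rewrite (leq_trans le2) // e2.
  by rewrite (ut_mul_at le12 le3) (ut_mul_at le1 le23) e1 e2 !eqxx.
- have le12 : (i1 <= j2)%N by rewrite (leq_trans le1) // e1.
  by rewrite (ut_mul_at le12 le3) (negPf n2) linear0.
- have le23 : (i2 <= j3)%N by rewrite (leq_trans le2) // e2.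
  by rewrite (ut_mul_at le1 le23) (negPf n1) -/(ut_mulr _ _) linear0.
- by rewrite linear0 -/(ut_mulr _ _) linear0.
Qed.

Lemma ut_mulA : associative (@ut_mul F).
Proof.
pose T := {linear UT F -> UT F}.
have mulEE k l w : ut_mul (E k) (ut_mul (E l) w) = ut_mul (ut_mul (E k) (E l)) w.
  apply: (eq_linear_ut (f := (ut_mul (E k) : T) \o (ut_mul (E l) : T))
                       (g := (ut_mul (ut_mul (E k) (E l)) : T))) => m /=.
  by rewrite -ut_mulEEE.
have mulE k v w : ut_mul (E k) (ut_mul v w) = ut_mul (ut_mul (E k) v) w.
  apply: (eq_linear_ut (f := (ut_mul (E k) : T) \o (ut_mulr w : T))
                       (g := (ut_mulr w : T) \o (ut_mul (E k) : T))) => l /=.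
  by rewrite /ut_mulr mulEE.
move=> u v w.
apply: (eq_linear_ut (f := (ut_mulr (ut_mul v w) : T))
                     (g := (ut_mulr w : T) \o (ut_mulr v : T))) => k /=.
exact: mulE.
Qed.

Lemma ut_mulDl u v w : ut_mul (u + v) w = ut_mul u w + ut_mul v w.
Proof. exact: (linearD (ut_mulr w)). Qed.

Lemma ut_mulDr u v w : ut_mul u (v + w) = ut_mul u v + ut_mul u w.
Proof. exact: (linearD (ut_mul u)). Qed.

Lemma ut_mulZl a u v : ut_mul (a *: u) v = a *: ut_mul u v.
Proof. exact: (linearZZ (ut_mulr v)). Qed.

Lemma ut_mulZr a u v : ut_mul u (a *: v) = a *: ut_mul u v.
Proof. exact: (linearZZ (ut_mul u)). Qed.

Lemma ut_mul0r u : ut_mul 0 u = 0.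
Proof. exact: (linear0 (ut_mulr u)). Qed.

Lemma ut_mulr0 u : ut_mul u 0 = 0.
Proof. exact: (linear0 (ut_mul u)). Qed.

End UTProduct.

(* The unitization F 1 + UT of the non-unital algebra UT.                    *)
Definition UT1 (F : fieldType) : Type := (F^o * UT F)%type.

Section Unitization.
Variable F : fieldType.

HB.instance Definition _ := GRing.Lmodule.on (UT1 F).

Implicit Types x y z : UT1 F.

Definition scalar_part x : F := x.1.
Definition ut_part x : UT F := x.2.

Definition ut1_one : UT1 F := (1, 0).
Definition ut1_mul x y : UT1 F :=
  (scalar_part x * scalar_part y,
   scalar_part x *: ut_part y + scalar_part y *: ut_part x
     + ut_mul (ut_part x) (ut_part y)).

Lemma ut1_eq x y :
  scalar_part x = scalar_part y -> ut_part x = ut_part y -> x = y.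
Proof. by case: x y => [a u] [b v]; rewrite /scalar_part /ut_part /= => -> ->. Qed.

Lemma ut1_mulA_aux (V : lmodType F) (a b c : F) (u v w uv vw uw uvw : V) :
  a *: (b *: w + c *: v + vw) + (b * c) *: u + (b *: uw + c *: uv + uvw) =
  (a * b) *: w + c *: (a *: v + b *: u + uv) + (a *: vw + b *: uw + uvw).
Proof.
rewrite !scalerDr !scalerA (mulrC c a) (mulrC c b) -!addrA.
congr (_ + (_ + _)).
rewrite addrCA; congr (_ + _).
rewrite [RHS]addrCA; congr (_ + _).
by rewrite addrCA.
Qed.

Lemma ut1_mulDl_aux (V : lmodType F) (a b c : F) (u v w uw vw : V) :
  (a + b) *: w + c *: (u + v) + (uw + vw) =
  (a *: w + c *: u + uw) + (b *: w + c *: v + vw).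
Proof.
by rewrite scalerDl scalerDr [RHS]addrACA; congr (_ + _); rewrite addrACA.
Qed.

Lemma ut1_mulDr_aux (V : lmodType F) (a b c : F) (u v w uv uw : V) :
  a *: (v + w) + (b + c) *: u + (uv + uw) =
  (a *: v + b *: u + uv) + (a *: w + c *: u + uw).
Proof.
by rewrite scalerDl scalerDr [RHS]addrACA; congr (_ + _); rewrite addrACA.
Qed.

Lemma scalar_partM x y :
  scalar_part (ut1_mul x y) = scalar_part x * scalar_part y.
Proof. by []. Qed.

Lemma ut_partM x y : ut_part (ut1_mul x y) =
  scalar_part x *: ut_part y + scalar_part y *: ut_part x
    + ut_mul (ut_part x) (ut_part y).
Proof. by []. Qed.

Lemma scalar_partD x y : scalar_part (x + y) = scalar_part x + scalar_part y.
Proof. by []. Qed.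

Lemma ut_partD x y : ut_part (x + y) = ut_part x + ut_part y.
Proof. by []. Qed.

Lemma ut1_mulA : associative ut1_mul.
Proof.
move=> x y z; apply: ut1_eq; rewrite ?scalar_partM ?ut_partM ?mulrA //.
rewrite !scalar_partM.
move: (scalar_part x) (scalar_part y) (scalar_part z) => a b c.
move: (ut_part x) (ut_part y) (ut_part z) => u v w.
rewrite (ut_mulDr u _ (ut_mul v w)) (ut_mulDr u (b *: w) _).
rewrite (ut_mulZr b u w) (ut_mulZr c u v).
rewrite (ut_mulDl _ (ut_mul u v) w) (ut_mulDl (a *: v) _ w).
rewrite (ut_mulZl a v w) (ut_mulZl b u w) (ut_mulA u v w).
exact: ut1_mulA_aux.
Qed.

Lemma ut1_mul1 : left_id ut1_one ut1_mul.
Proof.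
move=> y; apply: ut1_eq; rewrite ?scalar_partM ?ut_partM ?mul1r //.
by rewrite scale1r scaler0 addr0 ut_mul0r addr0.
Qed.

Lemma ut1_1mul : right_id ut1_one ut1_mul.
Proof.
move=> y; apply: ut1_eq; rewrite ?scalar_partM ?ut_partM ?mulr1 //.
by rewrite scale1r scaler0 add0r ut_mulr0 addr0.
Qed.

Lemma ut1_mulDl : left_distributive ut1_mul +%R.
Proof.
move=> x y z; apply: ut1_eq.
  by rewrite scalar_partD !scalar_partM scalar_partD mulrDl.
rewrite ut_partD !ut_partM scalar_partD ut_partD ut_mulDl.
exact: ut1_mulDl_aux.
Qed.

Lemma ut1_mulDr : right_distributive ut1_mul +%R.
Proof.
move=> x y z; apply: ut1_eq.
  by rewrite scalar_partD !scalar_partM scalar_partD mulrDr.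
rewrite ut_partD !ut_partM scalar_partD ut_partD ut_mulDr.
exact: ut1_mulDr_aux.
Qed.

Lemma ut1_one_neq0 : ut1_one != 0.
Proof. by apply/eqP => -[]/eqP; rewrite oner_eq0. Qed.

HB.instance Definition _ := GRing.Zmodule_isNzRing.Build (UT1 F)
  ut1_mulA ut1_mul1 ut1_1mul ut1_mulDl ut1_mulDr ut1_one_neq0.

Definition to_ut1 (u : UT F) : UT1 F := (0, u).

End Unitization.

Section Grading.
Variables (G : groupType) (eps : nat -> G).

Definition unit_deg (k : matrix_unit) : G :=
  (\prod_((val k).1 <= i < (val k).2) eps i)%g.

Definition ut_homog (F : fieldType) (g : G) (u : UT F) : Prop :=
  forall k, k \in msupp u -> unit_deg k = g.

Definition in_radical (k : matrix_unit) : bool := ((val k).1 < (val k).2)%N.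

(* The product is taken in the unitization, so the empty sequence is good.   *)
Definition good (F : fieldType) (eta : seq G) : Prop :=
  exists r : seq matrix_unit,
    [/\ all in_radical r,
        \prod_(k <- r) to_ut1 (munit F k) != 0
      & map unit_deg r = eta].

End Grading.

(* The pair (g, i) stands for the variable x_{i+1}^(g).                      *)
Definition freeAlg (F : fieldType) (G : groupType) :=
  {malg F[{fmonom (G * nat)%type}]}.

HB.instance Definition _ (F : fieldType) (G : groupType) :=
  GRing.Lalgebra.on (freeAlg F G).

HB.lock Definition xvar (F : fieldType) (G : groupType) (g : G) (i : nat) :
  freeAlg F G := << fmu (g, i) >>.
Arguments xvar F {G} g i.

Section FreeAlgebra.
Variables (F : fieldType) (G : groupType).
Local Notation freeAlg := (freeAlg F G).
Local Notation xvar := (@xvar F G).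

Definition yvar (i : nat) : freeAlg := xvar 1%g i.

Definition word_deg (w : {fmonom (G * nat)%type}) : G :=
  (\prod_(x <- (w : seq _)) x.1)%g.

Definition homog (g : G) (f : freeAlg) : Prop :=
  forall w, w \in msupp f -> word_deg w = g.

Definition eval (a : G * nat -> UT F) : freeAlg -> UT1 F :=
  lin_ext (fun w : {fmonom (G * nat)%type} =>
             \prod_(x <- (w : seq _)) to_ut1 (a x)).

Lemma eval_is_linear a : linear (eval a).
Proof. exact: lin_ext_is_linear. Qed.

HB.instance Definition _ a :=
  GRing.isLinear.Build F freeAlg (UT1 F) _ (eval a) (eval_is_linear a).

Definition graded_identity (eps : nat -> G) (f : freeAlg) : Prop :=
  forall a : G * nat -> UT F,
    (forall x, ut_homog eps x.1 (a x)) -> eval a f = 0.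

Definition IdG (eps : nat -> G) (f : freeAlg) : bool :=
  `[< graded_identity eps f >].

Definition ideal (I : freeAlg -> Prop) : Prop :=
  [/\ I 0, (forall f g, I f -> I g -> I (f + g))
    & forall f g h, I f -> I (g * f * h)].

Definition graded_ideal (I : freeAlg -> Prop) : Prop :=
  ideal I /\
  forall phi : {lrmorphism freeAlg -> freeAlg},
    (forall g f, homog g f -> homog g (phi f)) ->
    forall f, I f -> I (phi f).

Definition graded_ideal_generated (S : freeAlg -> Prop) (f : freeAlg) : Prop :=
  forall I, graded_ideal I -> (forall g, S g -> I g) -> I f.

Definition comm (a b : freeAlg) : freeAlg := a * b - b * a.

(* lcomm a [:: b_2; ...; b_s] is the left-normed commutator [a, b_2, ..., b_s] *)
Definition lcomm (a : freeAlg) (bs : seq freeAlg) : freeAlg := foldl comm a bs.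

(* The field F has exactly q elements.                                       *)
Definition card_field (q : nat) : Prop := ([set: F] #= `I_q)%card.

(* Factors are numbered from 0 and distinct factors share no variable.       *)
Definition identity_factor (i : nat) (f : freeAlg) : Prop :=
  [\/ exists2 g : G, g <> 1%g & f = xvar g i,
      f = comm (yvar (2 * i)) (yvar (2 * i + 1))
    | exists2 q, card_field q & f = yvar (2 * i) ^+ q - yvar (2 * i)].

Definition bad_product (eps : nat -> G) (f : freeAlg) : Prop :=
  exists m (c : 'I_m -> freeAlg) (eta : m.-tuple G),
    [/\ ~ good eps F eta,
        forall i : 'I_m, homog (tnth eta i) (c i),
        forall i : 'I_m, identity_factor i (c i)
      & f = \prod_(i < m) c i].

Definition semistandard (c : freeAlg) : Prop :=
  (exists g i (js : seq nat),
    [/\ g <> 1%g, sorted leq js & c = lcomm (xvar g i) (map yvar js)]) \/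
  (exists i j (js : seq nat),
    [/\ (j < i)%N, sorted leq (j :: js)
      & c = lcomm (yvar i) (map yvar (j :: js))]).

Definition L_normal (q : nat) (c : freeAlg) : Prop :=
  [\/ exists g i (js : seq nat),
        [/\ g <> 1%g, sorted leq js,
            forall k, (count_mem k js <= q - 1)%N
          & c = lcomm (xvar g i) (map yvar js)],
      exists i j (js : seq nat),
        [/\ (j < i)%N, sorted leq (j :: js),
            forall k, (count_mem k [:: i, j & js] <= q - 1)%N
          & c = lcomm (yvar i) (map yvar (j :: js))]
    | exists i (js : seq nat),
        [/\ sorted leq js, i \notin js,
            forall k, (count_mem k js <= q - 1)%N
          & c = lcomm (yvar i ^+ q - yvar i) (map yvar js)]].

Definition basis_factor (c : freeAlg) : Prop :=
  (infinite_set [set: F] /\ semistandard c) \/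
  (exists2 q, card_field q & L_normal q c).

Definition basis_product (eps : nat -> G) (f : freeAlg) : Prop :=
  exists s (a : 'I_s -> nat) m (c : 'I_m -> freeAlg) (eta : m.-tuple G),
    [/\ forall (i : 'I_s) q, card_field q -> (a i < q)%N,
        good eps F eta,
        forall i : 'I_m, homog (tnth eta i) (c i),
        forall i : 'I_m, basis_factor (c i)
      & f = (\prod_(i < s) yvar i ^+ a i) * \prod_(i < m) c i].

End FreeAlgebra.

Section RelativelyFree.
Variables (F : fieldType) (G : groupType) (eps : nat -> G).
Implicit Types f g : freeAlg F G.

Lemma IdG_linear a f g : f \in IdG eps -> g \in IdG eps ->
  a *: f + g \in (IdG eps : pred (freeAlg F G)).
Proof.
move=> /asboolP If /asboolP Ig; apply/asboolP => b hb.
by rewrite (eval_is_linear b a f g) (If b hb) (Ig b hb) scaler0 addr0.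
Qed.

Lemma IdG0 : 0 \in (IdG eps : pred (freeAlg F G)).
Proof. by apply/asboolP => b _; rewrite linear0. Qed.

Lemma IdG_zmod_closed : zmod_closed (IdG eps : pred (freeAlg F G)).
Proof.
split=> [|f g If Ig]; first exact: IdG0.
by rewrite -scaleN1r addrC; apply: IdG_linear.
Qed.

HB.instance Definition _ :=
  GRing.isZmodClosed.Build (freeAlg F G) (@IdG F G eps) IdG_zmod_closed.

Lemma IdGZ a f : f \in IdG eps -> a *: f \in (IdG eps : pred (freeAlg F G)).
Proof. by move=> If; rewrite -[_ *: _]addr0; apply: IdG_linear IdG0. Qed.

Local Notation I :=
  (GRing.ZmodClosed.clone (freeAlg F G) (@IdG F G eps) _).

Definition relFree := Quotient.quot I.

HB.instance Definition _ := GRing.Zmodule.on relFree.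
HB.instance Definition _ := EqQuotient.on relFree.

Definition relFree_pi (f : freeAlg F G) : relFree := \pi_relFree f.

(* Only the vector space structure of F<X^G>/Id_G(UT, eps) is needed.        *)
Definition relFree_scale (a : F) : relFree -> relFree :=
  fun x => relFree_pi (a *: repr x).

Lemma relFree_piP f g : (relFree_pi f = relFree_pi g) <-> (f - g \in I).
Proof. by rewrite Quotient.idealrBE; split => [/eqP|/eqP]. Qed.

Lemma relFree_piD f g : relFree_pi (f + g) = relFree_pi f + relFree_pi g.
Proof. exact: (raddfD (\pi_(Quotient.quot I))). Qed.

Lemma relFree_scale_pi a f :
  relFree_scale a (relFree_pi f) = relFree_pi (a *: f).
Proof.
apply/relFree_piP; rewrite -scalerBr; apply/IdGZ/relFree_piP.
by rewrite /relFree_pi reprK.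
Qed.

Lemma relFree_scaleA a b x :
  relFree_scale a (relFree_scale b x) = relFree_scale (a * b) x.
Proof. by rewrite [relFree_scale b x]/relFree_scale relFree_scale_pi scalerA. Qed.

Lemma relFree_scale1 : left_id 1 relFree_scale.
Proof. by move=> x; rewrite /relFree_scale scale1r /relFree_pi reprK. Qed.

Lemma relFree_scaleDr : right_distributive relFree_scale +%R.
Proof.
move=> a x y; rewrite -(reprK x) -(reprK y).
rewrite -/(relFree_pi (repr x)) -/(relFree_pi (repr y)) -relFree_piD.
by rewrite !relFree_scale_pi scalerDr relFree_piD.
Qed.

Lemma relFree_scaleDl x : {morph relFree_scale^~ x : a b / a + b}.
Proof. by move=> a b; rewrite /relFree_scale scalerDl relFree_piD. Qed.

HB.instance Definition _ := GRing.Zmodule_isLmodule.Build F relFree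
  relFree_scaleA relFree_scale1 relFree_scaleDr relFree_scaleDl.

End RelativelyFree.

(* The family (v i) indexed by the i satisfying D is a basis; in particular  *)
(* v is injective on D.                                                      *)
Definition is_basis (F : fieldType) (V : lmodType F) (I : choiceType)
    (D : I -> Prop) (v : I -> V) : Prop :=
  (forall (s : seq I) (a : I -> F),
     uniq s -> (forall i, i \in s -> D i) ->
     \sum_(i <- s) a i *: v i = 0 -> forall i, i \in s -> a i = 0) /\
  (forall x : V, exists (s : seq I) (a : I -> F),
     (forall i, i \in s -> D i) /\ x = \sum_(i <- s) a i *: v i).

(* Main.v *)
Require Import Defs.
From HB Require Import structures.
From mathcomp Require Import all_boot all_algebra.
From mathcomp Require Import finmap ring.
From mathcomp.multinomials Require Import monalg.
From mathcomp Require Import boolp classical_sets cardinality.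

Set Implicit Arguments.
Unset Strict Implicit.
Unset Printing Implicit Defensive.

Import GRing.Theory.

Local Open Scope ring_scope.

(** Every element of the free algebra is a combination of words of even
    variables followed by products of commutators, by collecting: even variables
    are moved to the left, each exchange leaving a commutator behind, and entries
    of commutators are rearranged, each exchange leaving a product of two
    shorter commutators ([bracket_swap]). Over a field with [q] elements the
    [q]th power of the bracket with [y] is the bracket with [y ^+ q]
    ([lbracket_card_field]), and [y ^+ q = y + (y ^+ q - y)], so that [q] equal
    entries reduce to one at the price of commutators that start with
    [y ^+ q - y]. This shows that the normal products span the free algebra
    ([word_straight]).

    The value of such a commutator in [UT] is strictly upper triangular, so a
    product of commutators whose degrees form a bad sequence is an identity; it
    is also a substitution instance of one of the given generators
    ([bad_atoms_ideal]), since every commutator arises by substitution from an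
    odd variable, a commutator of two even variables or [y ^+ q - y]. Hence every element is,
    up to the ideal generated by the bad products, a combination of the good
    normal products, and both assertions follow once the latter are shown to be
    independent modulo the identities.

    For independence ([basis_products_free]), a good sequence of length [m]
    yields rows [i_0 < ... < i_m] and hence matrices of order [m + 1] that are
    values of graded variables. With arbitrary diagonal entries for the even
    variables and arbitrary entries of the right degree just above the diagonal,
    the corner entry of a normal product with [m] commutators is a monomial in
    the first diagonal entries times one factor per commutator; that factor
    depends only on the entries just above the diagonal in its own row and on the
    difference of the two diagonal entries there ([chain_evaluation]). These data
    are independent of each other, so the problem reduces to a single commutator,
    where the functions are told apart by their leading monomials
    ([lead_coef_atom]). Products with more commutators have corner entry zero,
    and those with fewer are dealt with by induction. *)

(** * Fields with finitely many elements *)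

Section CardField.
Variable F : fieldType.

Lemma card_field_seq q : card_field F q ->
  exists s : seq F, [/\ uniq s, size s = q & forall x, x \in s].
Proof.
move=> /card_set_bijP[f [fI finj fsurj]].
have [g gK] : {g : nat -> F & forall i, (i < q)%N -> f (g i) = i}.
  apply: (@choice _ _ (fun i x => (i < q)%N -> f x = i)) => i.
  by have [/fsurj[x _ <-]|] := boolP (i < q)%N; [exists x | exists 0].
exists (map g (iota 0 q)); split.
- rewrite map_inj_in_uniq ?iota_uniq // => i j.
  by rewrite !mem_iota /= => /gK ig /gK jg /(congr1 f); rewrite ig jg.
- by rewrite size_map size_iota.
- move=> x; have fxq : (f x < q)%N := fI x I.
  have -> : x = g (f x) by apply: finj; rewrite ?inE // gK.
  by apply: map_f; rewrite mem_iota.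
Qed.

Lemma infinite_field_seq n : infinite_set [set: F] ->
  exists s : seq F, uniq s /\ (n <= size s)%N.
Proof.
move=> /(@infinite_set_fset F _ n)[B _ nB].
by exists (enum_fset B); split; rewrite ?fset_uniq.
Qed.

(** The value 0 stands for an infinite field, so that one number governs the
    exponents in both cases. *)
Definition field_size (q : nat) : Prop :=
  if q is 0 then infinite_set [set: F] else card_field F q.

Definition small (q a : nat) : bool := (q == 0%N) || (a < q)%N.

Lemma field_size_exists : exists q, field_size q.
Proof.
have [[q cq]|inf] := EM (finite_set [set: F]); last by exists 0%N.
have [s [_ sq ins]] := card_field_seq cq.
by exists q; case: q sq cq => // /size0nil s0; have := ins 0; rewrite s0.
Qed.

Lemma card_field_inj q q' : card_field F q -> card_field F q' -> q = q'.
Proof.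
move=> /card_field_seq[s [us <- ins]] /card_field_seq[s' [us' <- ins']].
by apply/perm_size/uniq_perm => // x; rewrite ins ins'.
Qed.

Lemma field_size_card q q' : field_size q -> card_field F q' -> q = q'.
Proof.
case: q => [inf cq|q]; last exact: card_field_inj.
by case: inf; exists q'.
Qed.

(** A nonzero polynomial has at most as many roots as its degree, which is
    below the number of elements of the field. *)
Lemma poly_vanish q (p : {poly F}) : field_size q ->
  (forall a, p`_a != 0 -> small q a) -> (forall t, p.[t] = 0) -> p = 0.
Proof.
move=> fq sm van; apply/eqP/contraT => p0.
have [s [us lts]] : exists s : seq F, uniq s /\ (size p <= size s)%N.
  case: q fq sm => [/infinite_field_seq//|q] cq sm.
  have [s [us ss _]] := card_field_seq cq; exists s; split=> //.
  have: small q.+1 (size p).-1 by apply: sm; rewrite -lead_coefE lead_coef_eq0.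
  by rewrite ss /small /= prednK // size_poly_gt0.
have := max_poly_roots p0 _ us; rewrite ltnNge lts; apply.
by apply/allP => t _; apply/eqP.
Qed.

Variables (q : nat) (cq : card_field F q).

Lemma card_field_gt1 : (1 < q)%N.
Proof.
have [s [us <- ins]] := card_field_seq cq.
have: (size [:: (0 : F)%R; 1%R] <= size s)%N.
  by apply: uniq_leq_size => //=; rewrite inE eq_sym oner_eq0.
by [].
Qed.

(** Multiplication by a nonzero element permutes the nonzero elements. *)
Lemma card_field_exp (x : F) : x ^+ q = x.
Proof.
have [s [us ss ins]] := card_field_seq cq.
have [->|x0] := eqVneq x 0; first by rewrite expr0n; case: (q) card_field_gt1.
pose s' := rem 0 s; have us' : uniq s' by rewrite rem_uniq.
have ins' y : (y \in s') = (y != 0) by rewrite mem_rem_uniq // !inE ins andbT.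
have pr : perm_eq (map ( *%R x) s') s'.
  apply: uniq_perm => // [|y]; first by rewrite map_inj_uniq //; apply: mulfI.
  rewrite ins'; apply/mapP/idP => [[z]|y0].
    by rewrite ins' => z0 ->; rewrite mulf_neq0.
  by exists (x^-1 * y); rewrite ?ins' ?mulf_neq0 ?invr_eq0 // mulVKf.
have : \prod_(y <- map ( *%R x) s') y = \prod_(y <- s') y by exact: perm_big.
rewrite big_map big_split /= big_const_seq count_predT iter_mulr_1 => e.
have P0 : \prod_(y <- s') y != 0 by rewrite prodf_seq_neq0; apply/allP => y; rewrite ins'.
have := mulIf P0 (etrans e (esym (mul1r _))).
rewrite size_rem // ss => ex.
by case: (q) card_field_gt1 ex => // r _ /=; rewrite exprS => ->; rewrite mulr1.
Qed.

(** The polynomial [('X + 1) ^+ q - 'X ^+ q - 1] has degree below [q] and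
    vanishes at every element of the field. *)
Lemma card_field_bin i : (0 < i < q)%N -> ('C(q, i)%:R : F) = 0.
Proof.
move=> /andP[i0 iq].
pose p : {poly F} := \poly_(i < q) (if i == 0%N then 0 else 'C(q, i)%:R).
have : p = 0.
  have fq : field_size q by have := card_field_gt1; case: (q) cq.
  apply: (poly_vanish fq) => [a|t].
    by rewrite coef_poly /small orbC; case: ifP => // _; rewrite eqxx.
  have qE : q = q.-1.+1 by rewrite prednK // ltnW // card_field_gt1.
  have := exprD1n t q; rewrite !card_field_exp big_ord_recr /= binn.
  rewrite mulr1n card_field_exp addrC => /addrI.
  rewrite horner_poly; move: (bin0 q); move: (binomial q) => c c0.
  rewrite qE !big_ord_recl /= mul0r add0r c0 mulr1n.
  rewrite -[LHS]addr0 => /addrI e; rewrite [RHS]e; apply: eq_bigr => j _.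
  by rewrite mulr_natl.
by move=> /polyP/(_ i); rewrite coef_poly iq coef0; case: (i) i0.
Qed.

Lemma card_field_expN1 : (-1 : F) ^+ q = -1.
Proof. exact: card_field_exp. Qed.

End CardField.

(** * Morphisms out of the free algebra *)

Section FreeAlgebraMorphisms.
Variables (F : fieldType) (G : groupType).
Local Notation A := (freeAlg F G).
Implicit Types (a : F) (f g h : A) (w : {fmonom (G * nat)%type}).

Definition monom w : A := << w >>.

Lemma free_scalerAr a f g : f * (a *: g) = a *: (f * g).
Proof.
rewrite [f * _](malgMEw (fsubset_refl _) (msuppZ_le _ _)).
rewrite [f * g](malgMEw (fsubset_refl _) (fsubset_refl _)) scaler_sumr.
apply: eq_bigr => k _; rewrite scaler_sumr; apply: eq_bigr => l _.
by apply/malgP => m; rewrite !(mcoeffZ, mcoeffU) mulrCA mulrnAr.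
Qed.

Lemma monomM w w' : monom w * monom w' = monom (mmul w w').
Proof. by rewrite /monom [LHS]malgM_def fgmulUU mulr1. Qed.

Lemma xvarE x : xvar F x.1 x.2 = monom (fmu x).
Proof. by case: x => g i; rewrite xvar.unlock. Qed.

Lemma monom_xvar w : monom w = \prod_(x <- (w : seq _)) xvar F x.1 x.2.
Proof.
case: w => s; elim: s => [|x s IH].
  by rewrite big_nil /monom; congr (<< _ >>); rewrite -fmoneE.
rewrite big_cons -IH xvarE monomM; congr monom.
by apply/val_inj; rewrite /= fmM fmU.
Qed.

Lemma free_linear_ind (P : A -> Prop) :
  P 0 -> (forall a f g, P f -> P g -> P (a *: f + g)) ->
  (forall w, P (monom w)) -> forall f, P f.
Proof.
move=> P0 PD PM f; rewrite (malg_expand f).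
elim: (enum_fset (msupp f)) => [|w s IH]; first by rewrite big_nil.
by rewrite big_cons; apply: PD (PM w) IH.
Qed.

End FreeAlgebraMorphisms.

HB.instance Definition _ (F : fieldType) (G : groupType) :=
  GRing.Lalgebra_isAlgebra.Build F (freeAlg F G) (fun a f g => esym (free_scalerAr a f g)).

Section Universal.
Variables (F : fieldType) (G : groupType) (R : algType F).
Local Notation A := (freeAlg F G).
Implicit Types (a : F) (f g h : A) (w : {fmonom (G * nat)%type}).
Variable b : G * nat -> R.

Definition fmorph : A -> R :=
  lin_ext (fun w => \prod_(x <- (w : seq _)) b x).

Lemma fmorph_is_linear : linear fmorph.
Proof. exact: lin_ext_is_linear. Qed.

Lemma fmorph_monom w : fmorph (monom F w) = \prod_(x <- (w : seq _)) b x.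
Proof. exact: lin_extU. Qed.

Lemma fmorph_xvar (c : G) i : fmorph (xvar F c i) = b (c, i).
Proof. by rewrite (xvarE F (c, i)) fmorph_monom fmU big_seq1. Qed.

Lemma fmorph1 : fmorph 1 = 1.
Proof.
have -> : (1 : A) = monom F mone by [].
by rewrite fmorph_monom fm1 big_nil.
Qed.

Lemma fmorphM f g : fmorph (f * g) = fmorph f * fmorph g.
Proof.
have fZ : forall a u v, fmorph (a *: u + v) = a *: fmorph u + fmorph v.
  exact: fmorph_is_linear.
have f0 : fmorph 0 = 0 by have := fZ (-1) 0 0; rewrite !scaleN1r !addNr.
elim/free_linear_ind: f => [|a f1 f2 IH1 IH2|w].
- by rewrite mul0r f0 mul0r.
- have eL : (a *: f1 + f2) * g = a *: (f1 * g) + f2 * g.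
    by rewrite mulrDl -scalerAl.
  have eR (r1 r2 r : R) : (a *: r1 + r2) * r = a *: (r1 * r) + r2 * r.
    by rewrite mulrDl -scalerAl.
  apply: etrans (congr1 fmorph eL) (etrans (fZ _ _ _) _).
  apply: etrans (congr2 (fun u v => a *: u + v) IH1 IH2) _.
  exact: etrans (esym (eR _ _ _)) (congr1 ( *%R^~ _) (esym (fZ _ _ _))).
elim/free_linear_ind: g => [|a f1 f2 IH1 IH2|w'].
- by rewrite mulr0 f0 mulr0.
- have eL : monom F w * (a *: f1 + f2) = a *: (monom F w * f1) + monom F w * f2.
    by rewrite mulrDr free_scalerAr.
  have eR (r1 r2 r : R) : r * (a *: r1 + r2) = a *: (r * r1) + r * r2.
    by rewrite mulrDr -scalerAr.
  apply: etrans (congr1 fmorph eL) (etrans (fZ _ _ _) _).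
  apply: etrans (congr2 (fun u v => a *: u + v) IH1 IH2) _.
  exact: etrans (esym (eR _ _ _)) (congr1 ( *%R _) (esym (fZ _ _ _))).
apply: etrans (congr1 fmorph (monomM F w w')) _.
rewrite (fmorph_monom (mmul w w')) fmM big_cat.
exact: (congr2 *%R (esym (fmorph_monom w)) (esym (fmorph_monom w'))).
Qed.

Lemma fmorph_is_monoid_morphism : monoid_morphism fmorph.
Proof. by split; [exact: fmorph1 | exact: fmorphM]. Qed.

HB.instance Definition _ :=
  GRing.isLinear.Build F A R _ fmorph fmorph_is_linear.
HB.instance Definition _ :=
  GRing.isMonoidMorphism.Build A R fmorph fmorph_is_monoid_morphism.

Lemma eq_lrmorph_free (p q : {lrmorphism A -> R}) :
  (forall (c : G) i, p (xvar F c i) = q (xvar F c i)) -> p =1 q.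
Proof.
move=> e; elim/free_linear_ind => [|a f g IH1 IH2|w].
- by rewrite !raddf0.
- have lin (r : {lrmorphism A -> R}) : r (a *: f + g) = a *: r f + r g.
    exact: linearP.
  by rewrite !lin IH1 IH2.
- by rewrite monom_xvar !rmorph_prod; apply: eq_bigr => x _; exact: e.
Qed.

End Universal.

(** * Linear spans *)

Section Span.
Variables (F : fieldType) (V : lmodType F).
Implicit Types (S : V -> Prop) (u v : V).

Inductive span S : V -> Prop :=
| span0 : span S 0
| span_cons a u v : S u -> span S v -> span S (a *: u + v).

Lemma span_gen S u : S u -> span S u.
Proof. by move=> Su; rewrite -[u]addr0 -[u]scale1r; apply: span_cons Su (span0 _). Qed.

Lemma spanDZ S a u v : span S u -> span S v -> span S (a *: u + v).
Proof.
move=> Su Sv; elim: Su => [|b x y Sx _ IH]; first by rewrite scaler0 add0r.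
by rewrite scalerDr scalerA -addrA; apply: span_cons.
Qed.

Lemma spanD S u v : span S u -> span S v -> span S (u + v).
Proof. by move=> Su Sv; rewrite -[u]scale1r; apply: spanDZ. Qed.

Lemma spanZ S a u : span S u -> span S (a *: u).
Proof. by move=> Su; rewrite -[_ *: _]addr0; apply: spanDZ Su (span0 _). Qed.

Lemma spanN S u : span S u -> span S (- u).
Proof. by move=> Su; rewrite -scaleN1r; apply: spanZ. Qed.

Lemma spanB S u v : span S u -> span S v -> span S (u - v).
Proof. by move=> Su Sv; apply: spanD Su (spanN Sv). Qed.

Lemma span_sub S v u : span S (u - v) -> span S v -> span S u.
Proof. by move=> Suv Sv; rewrite -(subrK v u); apply: spanD. Qed.

End Span.

Lemma span_bind (F : fieldType) (V W : lmodType F) (S : V -> Prop)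
    (T : W -> Prop) (f : V -> W) :
  (forall a u v, f (a *: u + v) = a *: f u + f v) ->
  (forall u, S u -> span T (f u)) -> forall u, span S u -> span T (f u).
Proof.
move=> lin ST u; elim=> [|a v w Sv _ IH]; last by rewrite lin; apply: spanDZ (ST _ Sv) IH.
by have := lin (-1) 0 0; rewrite !scaleN1r !addNr => ->; apply: span0.
Qed.

Lemma span_mono (F : fieldType) (V : lmodType F) (S T : V -> Prop) u :
  (forall v, S v -> span T v) -> span S u -> span T u.
Proof. by move=> ST; apply: (span_bind (f := id)). Qed.

(** Two rearrangements of a sequence are linked by adjacent exchanges, so a
    function of sequences that changes within a subspace under each of these
    changes within the subspace under every rearrangement. *)
Lemma span_perm (F : fieldType) (V : lmodType F) (S : V -> Prop) (n : nat)
    (E : seq nat -> V) :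
  (forall p a b s, (size (p ++ [:: a, b & s]) <= n)%N ->
     span S (E (p ++ [:: a, b & s]) - E (p ++ [:: b, a & s]))) ->
  forall s s', perm_eq s s' -> (size s <= n)%N -> span S (E s - E s').
Proof.
move=> sw.
have front x s2 s1 p : (size (p ++ s1 ++ x :: s2) <= n)%N ->
    span S (E (p ++ s1 ++ x :: s2) - E (p ++ x :: s1 ++ s2)).
  elim: s1 p => [|y s1 IH] p sz; first by rewrite subrr; apply: span0.
  rewrite -(subrK (E ((rcons p y) ++ x :: s1 ++ s2)) (E _)) -addrA.
  apply: spanD.
    by have := IH (rcons p y); rewrite !cat_rcons; apply.
  rewrite cat_rcons; apply: sw.
  by move: sz; rewrite !size_cat /= !size_cat /= !addnS.
suff gen s s' p : perm_eq s s' -> (size (p ++ s) <= n)%N ->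
    span S (E (p ++ s) - E (p ++ s')) by move=> s s'; apply: (gen s s' [::]).
elim: s s' p => [|x s IH] s' p.
  by rewrite perm_sym => /perm_nilP -> _; rewrite subrr; apply: span0.
move=> pe sz; have xs' : x \in s' by rewrite -(perm_mem pe) inE eqxx.
case/splitPr: xs' pe => s1 s2; rewrite (perm_sym (x :: s)) perm_catC /= perm_cons => pe.
rewrite -[E _](subrK (E (p ++ x :: s1 ++ s2))) -addrA; apply: spanD.
  have := IH (s1 ++ s2) (rcons p x); rewrite !cat_rcons; apply => //.
  by rewrite perm_sym perm_catC.
rewrite -opprB; apply/spanN/front.
by move: sz; rewrite !size_cat /= -(perm_size pe) size_cat; rewrite !addnS (addnC (size s2)).
Qed.

(** * Commutators in an algebra *)

Section Commutators.
Variables (F : fieldType) (A : algType F).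
Implicit Types (a : F) (u v w f g h t : A) (bs cs : seq A).

Definition bracket u v := u * v - v * u.
Definition lbracket u bs := foldl bracket u bs.

Lemma bracketC u v : bracket u v = - bracket v u.
Proof. by rewrite /bracket opprB. Qed.

Lemma bracketxx u : bracket u u = 0.
Proof. exact: subrr. Qed.

Lemma bracket_linear a f g t :
  bracket (a *: f + g) t = a *: bracket f t + bracket g t.
Proof.
rewrite /bracket mulrDl mulrDr -scalerAr -scalerAl scalerBr opprD.
by rewrite addrACA.
Qed.

Lemma bracketBl u v t : bracket (u - v) t = bracket u t - bracket v t.
Proof. by have := bracket_linear (-1) v u t; rewrite !scaleN1r ![- _ + _]addrC. Qed.

Lemma bracketBr u v t : bracket t (u - v) = bracket t u - bracket t v.
Proof. by rewrite ![bracket t _]bracketC bracketBl opprB opprK addrC. Qed.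

Lemma bracketMl u v t : bracket (u * v) t = bracket u t * v + u * bracket v t.
Proof. by rewrite /bracket mulrBl mulrBr !mulrA [RHS]addrC addrA subrK. Qed.

Lemma lbracket_linear a f g bs :
  lbracket (a *: f + g) bs = a *: lbracket f bs + lbracket g bs.
Proof. by elim: bs f g => //= t bs IH f g; rewrite bracket_linear IH. Qed.

Lemma lbracket0 bs : lbracket 0 bs = 0.
Proof. by have := lbracket_linear (-1) 0 0 bs; rewrite !scaleN1r !addNr. Qed.

Lemma lbracketN f bs : lbracket (- f) bs = - lbracket f bs.
Proof. by have := lbracket_linear (-1) f 0 bs; rewrite lbracket0 !scaleN1r !addr0. Qed.

Lemma lbracketD f g bs : lbracket (f + g) bs = lbracket f bs + lbracket g bs.
Proof. by have := lbracket_linear 1 f g bs; rewrite !scale1r. Qed.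

Lemma lbracketB f g bs : lbracket (f - g) bs = lbracket f bs - lbracket g bs.
Proof. by rewrite lbracketD lbracketN. Qed.

Lemma lbracket_cat f bs cs : lbracket f (bs ++ cs) = lbracket (lbracket f bs) cs.
Proof. exact: foldl_cat. Qed.

(** Bracketing on the right is a derivation, so a left-normed commutator of a
    product is a sum over the ways to share out the entries. *)
Lemma lbracketM (T : Type) (y : T -> A) f g (js : seq T) :
  span (fun u => exists s1 s2, (size s1 + size s2 = size js)%N /\
                 u = lbracket f (map y s1) * lbracket g (map y s2))
       (lbracket (f * g) (map y js)).
Proof.
elim: js f g => [|j js IH] f g /=.
  by apply: span_gen; exists [::], [::].
rewrite bracketMl lbracketD; apply: spanD;
  apply: span_mono (IH _ _) => _ [s1 [s2 [sz ->]]]; apply: span_gen.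
- by exists (j :: s1), s2; rewrite -sz.
- by exists s1, (j :: s2); rewrite -sz addnS.
Qed.

Lemma bracket_swap u v t :
  bracket (bracket u v) t - bracket (bracket u t) v =
  u * bracket v t - bracket v t * u.
Proof.
have cancel4 (p q r s : A) : p + q - (r + s) - (p - s) = q - r.
  by rewrite opprB opprD !addrA subrK [p + q]addrC addrAC addrK.
by rewrite {1}[bracket u v]/bracket bracketBl !bracketMl cancel4.
Qed.

Lemma bracket_jacobi u v t :
  bracket (bracket u v) t = bracket (bracket u t) v - bracket (bracket v t) u.
Proof.
have /(canRL (subrK _)) -> := bracket_swap u v t.
by rewrite [bracket (bracket v t) u]/bracket opprB addrC.
Qed.

(** The left and right multiplications by [v] commute, and the operator
    [bracket _ v] is their difference. *)
Lemma lbracket_nseq u v n : lbracket u (nseq n v) =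
  \sum_(i < n.+1) ((-1) ^+ i *+ 'C(n, i) : F) *: (v ^+ i * u * v ^+ (n - i)).
Proof.
elim: n => [|n IH].
  by rewrite big_ord_recl big_ord0 /= addr0 mulr1n scale1r mul1r mulr1.
pose T i k := v ^+ i * u * v ^+ k.
pose c m i : F := (-1) ^+ i *+ 'C(m, i).
rewrite -addn1 nseqD lbracket_cat IH /= addn1 -/(c _ _).
have -> : bracket (\sum_(i < n.+1) c n i *: T i (n - i)%N) v =
  \sum_(i < n.+1) c n i *: T i (n.+1 - i)%N -
  \sum_(i < n.+1) c n i *: T i.+1 (n - i)%N.
  rewrite /bracket mulr_suml mulr_sumr; congr (_ - _); apply: eq_bigr => i _.
    by rewrite -scalerAl /T -!mulrA -exprSr subSn // -ltnS.
  by rewrite -scalerAr /T !mulrA -exprS.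
rewrite big_ord_recl [in RHS]big_ord_recl /= -!/(T _ _) !subn0.
rewrite -addrA; congr (_ + _); first by rewrite /c !bin0.
rewrite [in RHS]big_ord_recr [in X in _ - X]big_ord_recr /= opprD addrA.
rewrite -sumrB; congr (_ + _); last first.
  by rewrite /c !binn !mulr1n exprS mulN1r scaleNr subSS.
apply: eq_bigr => i _; rewrite /bump /= !add1n !subSS -scalerBl.
congr (_ *: _); rewrite /c binS mulrnDr; congr (_ + _).
by rewrite exprS mulN1r mulNrn.
Qed.

(** In a field with [q] elements the interior binomial coefficients of order
    [q] vanish. *)
Lemma lbracket_card_field q u v : card_field F q ->
  lbracket u (nseq q v) = bracket u (v ^+ q).
Proof.
move=> cq; have q1 := card_field_gt1 cq.
have ends (f : nat -> A) n : (0 < n)%N ->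
    (forall i, (0 < i < n)%N -> f i = 0) -> \sum_(i < n.+1) f i = f 0%N + f n.
  case: n => // n _ f0; rewrite big_ord_recr big_ord_recl /= big1 ?addr0 //.
  by move=> i _; apply: f0; rewrite /bump /= add1n !ltnS ltn_ord.
pose f i : A := ((-1) ^+ i *+ 'C(q, i) : F) *: (v ^+ i * u * v ^+ (q - i)).
rewrite lbracket_nseq (ends f) {}/f.
- rewrite bin0 binn subn0 subnn !mulr1n (card_field_expN1 cq) scale1r scaleN1r.
  by rewrite mul1r mulr1.
- exact: ltnW.
by move=> i /(card_field_bin cq) b0; rewrite -mulr_natr b0 mulr0 scale0r.
Qed.

End Commutators.

(** * Straightening words into normal products *)

Section Words.
Variables (F : fieldType) (G : groupType).

(** An atom [(h, js)] encodes the left-normed commutator that starts with the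
    head [h], an odd variable, a commutator of two even variables or
    [y ^+ q - y], and goes on with the even variables numbered by [js]. Every
    factor of a basis product is the value of an atom. *)
Inductive atom_head := Hodd of G & nat | Heven of nat & nat | Hpow of nat.

HB.instance Definition _ := gen_eqMixin atom_head.
HB.instance Definition _ := gen_choiceMixin atom_head.

Definition atom := (atom_head * seq nat)%type.

Definition reduced (q : nat) (s : seq nat) := all (fun k => small q (count_mem k s)) s.

(** For an infinite field, where [q] is 0, the heads [Hpow] are excluded. *)
Definition valid (q : nat) (h : atom_head) : bool :=
  match h with Hodd g _ => g != 1%g | Heven _ _ => true | Hpow _ => (0 < q)%N end.

Definition normal (q : nat) (c : atom) : bool :=
  let: (h, js) := c in valid q h &&
  match h with
  | Hodd _ _ => sorted leq js && reduced q js
  | Heven i j => [&& (j < i)%N, path leq j js & reduced q [:: i, j & js]]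
  | Hpow i => [&& sorted leq js, i \notin js & reduced q js]
  end.

(** Weights are degrees of polynomials; the straightening of an atom is by
    induction on the weight. *)
Definition head_weight (q : nat) (h : atom_head) : nat :=
  match h with Hodd _ _ => 1 | Heven _ _ => 2 | Hpow _ => q end.

Definition weight (q : nat) (c : atom) : nat := (head_weight q c.1 + size c.2)%N.

Section Values.
Variables (A : algType F) (x : G * nat -> A) (q : nat).
Let y i := x (1%g, i).

Definition head_val (h : atom_head) : A :=
  match h with
  | Hodd g i => x (g, i) | Heven i j => bracket (y i) (y j) | Hpow i => y i ^+ q - y i
  end.

Definition atom_val (c : atom) : A := lbracket (head_val c.1) (map y c.2).
Definition atoms_val (l : seq atom) : A := \prod_(c <- l) atom_val c.
Definition evens_val (m : seq nat) : A := \prod_(i <- m) y i.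

End Values.

Lemma reducedP q s : reflect (forall k, small q (count_mem k s)) (reduced q s).
Proof.
apply: (iffP allP) => [h k|h k _]; last exact: h.
have [/h//|/count_memPn ->] := boolP (k \in s).
by rewrite /small; case: q {h}.
Qed.

Lemma perm_reduced q s s' : perm_eq s s' -> reduced q s = reduced q s'.
Proof.
by move=> /permP pe; apply/reducedP/reducedP => h k; rewrite ?pe // -pe.
Qed.

Lemma not_reduced q s : ~~ reduced q s ->
  exists k, (0 < q)%N /\ (q <= count_mem k s)%N.
Proof.
by case/allPn => k _; rewrite /small negb_or -leqNgt lt0n => /andP[]; exists k.
Qed.

Lemma perm_nseq_count (k n : nat) s : (n <= count_mem k s)%N ->
  exists s', perm_eq s (nseq n k ++ s').
Proof.
elim: n s => [|n IH] s le; first by exists s.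
have ks : k \in s by rewrite -has_pred1 has_count (leq_trans _ le).
have pe := perm_to_rem ks.
have [|s' pe'] := IH (rem k s).
  by move: le; rewrite (permP pe (pred1 k)) /= eqxx.
by exists s'; rewrite (perm_trans pe) //= perm_cons.
Qed.

End Words.

Section Straightening.
Variables (F : fieldType) (G : groupType) (A : algType F) (x : G * nat -> A).
Variables (q : nat) (fq : field_size F q).
Let y i := x (1%g, i).
Local Notation atom := (atom G).
Local Notation hval := (head_val x q).
Local Notation aval := (atom_val x q).
Implicit Types (c : atom) (h : atom_head G) (l : seq atom) (u v f : A) (js : seq nat).

Definition normal_product (w : nat) f : Prop := exists l,
  [/\ all (normal q) l, (sumn (map (weight q) l) <= w)%N & f = atoms_val x q l].

Lemma normal_span_mono w w' f : (w <= w')%N ->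
  span (normal_product w) f -> span (normal_product w') f.
Proof.
move=> le; apply: span_mono => _ [l [nl lw ->]]; apply: span_gen; exists l.
by split=> //; apply: leq_trans le.
Qed.

Lemma normal_spanM w w' u v : span (normal_product w) u ->
  span (normal_product w') v -> span (normal_product (w + w')) (u * v).
Proof.
move=> Su Sv; move: u Su; apply: (span_bind (f := fun u => u * v)) => [a f g|].
  by rewrite mulrDl -scalerAl.
move=> _ [l [nl lw ->]]; move: v Sv.
apply: (span_bind (f := fun v => _ * v)) => [a f g|].
  by rewrite mulrDr -scalerAr.
move=> _ [l' [nl' lw' ->]]; apply: span_gen; exists (l ++ l').
rewrite all_cat nl nl' map_cat sumn_cat leq_add // /atoms_val big_cat.
by split.
Qed.

Lemma field_size_gt1 : (0 < q)%N -> (1 < q)%N.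
Proof. by case: (q) fq => // r cq _; apply: card_field_gt1 cq. Qed.

Lemma lbracket_field_size u v : (0 < q)%N ->
  lbracket u (nseq q v) = bracket u v + bracket u (v ^+ q - v).
Proof.
move=> q0; rewrite bracketBr addrC subrK.
by apply: lbracket_card_field; case: (q) q0 fq.
Qed.

Lemma head_weight_gt0 h : valid q h -> (0 < head_weight q h)%N.
Proof. by case: h. Qed.

Section Step.
Variable w : nat.
Hypothesis IH : forall c, valid q c.1 -> (weight q c < w)%N ->
  span (normal_product (weight q c)) (aval c).
Local Notation B := (span (normal_product w)).

Lemma lower_atom c : valid q c.1 -> (weight q c < w)%N -> B (aval c).
Proof. by move=> vc ltw; apply: normal_span_mono (ltnW ltw) (IH vc ltw). Qed.

(** Modulo lower weights a product of two atoms is negligible, since each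
    factor is itself of lower weight. *)
Lemma two_atoms c1 c2 : valid q c1.1 -> valid q c2.1 ->
  (weight q c1 + weight q c2 <= w)%N -> B (aval c1 * aval c2).
Proof.
move=> v1 v2 le; apply: (normal_span_mono le).
have h1 := head_weight_gt0 v1; have h2 := head_weight_gt0 v2.
apply: normal_spanM; apply: IH => //; apply: leq_trans le.
  by rewrite -addn1 leq_add2l (leq_trans h2) // leq_addr.
by rewrite -add1n leq_add2r (leq_trans h1) // leq_addr.
Qed.

Lemma two_atoms_bracket c1 c2 js : valid q c1.1 -> valid q c2.1 ->
  (weight q c1 + weight q c2 + size js <= w)%N ->
  B (lbracket (aval c1 * aval c2) (map y js)).
Proof.
move=> v1 v2 le; apply: span_mono (lbracketM _ _ _ _) => _ [s1 [s2 [sz ->]]].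
rewrite /atom_val -!lbracket_cat -!map_cat.
apply: (two_atoms (c1 := (c1.1, c1.2 ++ s1)) (c2 := (c2.1, c2.2 ++ s2))) => //.
apply: leq_trans le; rewrite /weight /= !size_cat -sz !addnA.
by rewrite (addnAC _ (size s1)) (addnAC _ (size s1)).
Qed.

(** By [bracket_swap] an exchange of two entries costs the product of
    commutators [u * [v, t]] and its reverse, carrying the later entries, hence
    only products of two atoms. *)
Lemma atom_perm h js js' : valid q h -> (head_weight q h + size js <= w)%N ->
  perm_eq js js' -> B (aval (h, js) - aval (h, js')).
Proof.
move=> vh le pe; apply: (span_perm (n := size js) (E := fun s => aval (h, s))) pe _ => //.
move=> p a b s sz; rewrite /atom_val /= !map_cat !lbracket_cat /=.
rewrite -lbracketB bracket_swap lbracketB.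
have tot : (head_weight q h + size p + 2 + size s <= w)%N.
  by apply: leq_trans le; rewrite -!addnA leq_add2l; move: sz; rewrite size_cat.
pose c1 : atom := (h, p); pose c2 : atom := (Heven G a b, [::]).
rewrite -[lbracket (hval h) _]/(aval c1) -[bracket (y a) _]/(aval c2).
apply: spanB; apply: two_atoms_bracket => //; rewrite /weight /= addn0 //.
by rewrite [(2 + _)%N]addnC.
Qed.

Lemma atom_perm_in h js js' : valid q h -> (head_weight q h + size js <= w)%N ->
  perm_eq js js' -> B (aval (h, js')) -> B (aval (h, js)).
Proof. by move=> vh le pe; apply/span_sub/atom_perm. Qed.

(** Since [lbracket u (nseq q v)] is [bracket u v + bracket u (v ^+ q - v)],
    [q] equal entries can be replaced by one, up to products of two atoms. *)
Lemma atom_count k h js : (0 < q)%N -> valid q h ->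
  (head_weight q h + size js <= w)%N -> (q <= count_mem k js)%N -> B (aval (h, js)).
Proof.
move=> q0 vh le /perm_nseq_count[s pe].
apply: (atom_perm_in vh le pe); rewrite /atom_val /= map_cat map_nseq lbracket_cat.
rewrite (lbracket_field_size _ _ q0) lbracketD; have q1 := field_size_gt1 q0.
move: le; rewrite (perm_size pe) size_cat size_nseq => le.
apply: spanD.
  apply: (@lower_atom (h, k :: s)) => //; apply: leq_trans le.
  by rewrite /weight /= ltn_add2l -[(size s).+1]add1n ltn_add2r.
pose c1 : atom := (h, [::]); pose c2 : atom := (Hpow G k, [::]).
rewrite -[hval h]/(aval c1) -[y k ^+ q - _]/(aval c2) lbracketB.
apply: spanB; apply: two_atoms_bracket => //; rewrite /weight /= !addn0 //.
  by rewrite -addnA.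
by rewrite [(q + _)%N]addnC -addnA.
Qed.

Lemma normal_atom c : normal q c -> (weight q c <= w)%N -> B (aval c).
Proof.
move=> nc le; apply: span_gen; exists [:: c].
by rewrite /= nc addn0 /atoms_val big_seq1.
Qed.

Lemma sort_leq_sorted s : sorted leq (sort leq s).
Proof. exact/sort_sorted/leq_total. Qed.

Lemma perm_sort_leq s : perm_eq s (sort leq s).
Proof. by rewrite perm_sym perm_sort. Qed.

Lemma odd_atom g i js : g != 1%g -> (1 + size js <= w)%N -> B (aval (Hodd g i, js)).
Proof.
move=> g1 le; have [red|/not_reduced[k [q0 leq]]] := boolP (reduced q js); last first.
  exact: (atom_count (k := k)).
apply: (atom_perm_in _ _ (perm_sort_leq js)) => //.
apply: normal_atom; last by rewrite /weight /= size_sort.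
by rewrite /= g1 sort_leq_sorted -(perm_reduced _ (perm_sort_leq js)).
Qed.

(** An entry equal to the variable of the head can be moved next to it, where
    it commutes with the head. *)
Lemma pow_atom i js : (0 < q)%N -> (q + size js <= w)%N -> B (aval (Hpow G i, js)).
Proof.
move=> q0 le; have [ijs|ijs] := boolP (i \in js).
  have pe := perm_to_rem ijs; apply: (atom_perm_in _ _ pe) => //.
  rewrite /atom_val /= bracketBl bracketxx subr0.
  have -> : bracket (y i ^+ q) (y i) = 0.
    by rewrite /bracket -exprSr -exprS subrr.
  by rewrite lbracket0; apply: span0.
have [red|/not_reduced[k [_ leq]]] := boolP (reduced q js); last first.
  exact: (atom_count (k := k)).
apply: (atom_perm_in _ _ (perm_sort_leq js)) => //.
apply: normal_atom; last by rewrite /weight /= size_sort.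
by rewrite /= q0 sort_leq_sorted mem_sort ijs -(perm_reduced _ (perm_sort_leq js)).
Qed.

Lemma even_atomC i j js : aval (Heven G i j, js) = - aval (Heven G j i, js).
Proof. by rewrite /atom_val /= bracketC lbracketN. Qed.

(** The second variable of the head counts as an entry: together with [q - 1]
    equal entries it makes [q] consecutive brackets with one variable. *)
Lemma even_atom_count i j js : (0 < q)%N -> (2 + size js <= w)%N ->
  (q - 1 <= count_mem j js)%N -> B (aval (Heven G i j, js)).
Proof.
move=> q0 le /perm_nseq_count[s pe]; have q1 := field_size_gt1 q0.
apply: (atom_perm_in _ _ pe) => //.
move: le; rewrite (perm_size pe) size_cat size_nseq => le.
have -> : aval (Heven G i j, nseq (q - 1) j ++ s) =
    aval (Heven G i j, s) - aval (Hpow G j, i :: s).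
  rewrite /atom_val /= map_cat map_nseq lbracket_cat -lbracketB.
  congr (lbracket _ _); rewrite -[bracket (_ - _) _]opprK -bracketC opprK.
  rewrite -lbracket_field_size // -[in RHS](subnKC q0) add1n.
  by [].
apply: spanB.
  apply: lower_atom => //; apply: leq_trans le.
  by rewrite /weight /= ltn_add2l -[ltnLHS]add0n ltn_add2r subn_gt0.
apply: pow_atom => //; apply: leq_trans le.
by rewrite -{1}(subnKC q0) /= !addnS !add1n.
Qed.

(** With the least variable in second position and the entries sorted, the
    atom is normal unless a variable is repeated [q] times in all. If that
    variable is the first of the head, exchanging the two variables of the head
    brings it to the second position. *)
Lemma even_atom_min i j js : (j < i)%N -> all (leq j) js ->
  (2 + size js <= w)%N -> B (aval (Heven G i j, js)).
Proof.
move=> ltji lejs le.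
have [red|/not_reduced[k [q0]]] := boolP (reduced q [:: i, j & js]).
  apply: (atom_perm_in _ _ (perm_sort_leq js)) => //.
  apply: normal_atom; last by rewrite /weight /= size_sort.
  have pe : perm_eq [:: i, j & js] [:: i, j & sort leq js].
    by rewrite !perm_cons perm_sort_leq.
  rewrite /= ltji path_min_sorted ?sort_leq_sorted -?(perm_reduced _ pe) //.
  by rewrite (perm_all _ (perm_sort_leq js)) in lejs.
have [->|ki] /= := eqVneq k i.
  rewrite eqxx (ltn_eqF ltji) add0n => leq; rewrite even_atomC.
  by apply/spanN/even_atom_count; rewrite // leq_subLR.
have [->|kj] /= := eqVneq k j.
  rewrite (gtn_eqF ltji) add0n => leq.
  by apply: even_atom_count; rewrite // leq_subLR.
rewrite eq_sym (negPf ki) !add0n => leq.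
exact: (atom_count (k := k)).
Qed.

(** The Jacobi identity brings the least variable into the head. *)
Lemma even_atom i j js : (2 + size js <= w)%N -> B (aval (Heven G i j, js)).
Proof.
have [->|neq] := eqVneq i j.
  by rewrite /atom_val /= bracketxx lbracket0 => _; apply: span0.
wlog ltji : i j {neq} / (j < i)%N => [hwlog le|le].
  move: neq; rewrite neq_ltn => /orP[lt|lt]; last exact: hwlog.
  by rewrite even_atomC; apply/spanN/hwlog.
have [lejs|nle] := boolP (all (leq j) js); first exact: even_atom_min.
have srt := sort_leq_sorted js; have pe := perm_sort_leq js.
case es: (sort leq js) srt pe => [|k s] srt pe.
  by move: nle; rewrite (perm_all _ pe).
apply: (atom_perm_in _ _ pe) => //.
have leks : all (leq k) s by apply: order_path_min srt; apply: leq_trans.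
have ltkj : (k < j)%N.
  rewrite ltnNge; apply: contra nle => lejk; rewrite (perm_all _ pe) /= lejk.
  by apply: sub_all leks => m; apply: leq_trans.
have -> : aval (Heven G i j, k :: s) =
    aval (Heven G i k, j :: s) - aval (Heven G j k, i :: s).
  by rewrite /atom_val /= bracket_jacobi lbracketB.
move: le; rewrite (perm_size pe) => le.
apply: spanB; apply: even_atom_min => //=.
- exact: ltn_trans ltji.
- by rewrite leks ltnW.
- by rewrite leks ltnW // (ltn_trans ltkj).
Qed.

End Step.

Lemma atom_normal_span c : valid q c.1 ->
  span (normal_product (weight q c)) (aval c).
Proof.
move: {2}(weight q c) (leqnn (weight q c)) => n; elim/ltn_ind: n c => n IH c le vc.
have IH' c' : valid q c'.1 -> (weight q c' < weight q c)%N ->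
    span (normal_product (weight q c')) (aval c').
  by move=> vc' lt; apply: IH (leqnn _) vc'; apply: leq_trans lt le.
case: c le vc IH' => [[g i|i j|i] js] le vc IH'.
- exact: (odd_atom IH').
- exact: (even_atom IH').
- exact: (pow_atom IH').
Qed.

Definition raw_product f : Prop := exists2 l,
  all (fun c => valid q c.1) l & f = atoms_val x q l.

Definition straight_product f : Prop := exists m l,
  [/\ sorted leq m, reduced q m, all (normal q) l
    & f = evens_val x m * atoms_val x q l].

Lemma raw_atom c : valid q c.1 -> span raw_product (aval c).
Proof.
by move=> vc; apply: span_gen; exists [:: c]; rewrite /= ?vc // /atoms_val big_seq1.
Qed.

Lemma raw_one : span raw_product 1.
Proof. by apply: span_gen; exists [::]; rewrite // /atoms_val big_nil. Qed.

Lemma raw_spanM u v : span raw_product u -> span raw_product v ->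
  span raw_product (u * v).
Proof.
move=> Su Sv; move: u Su; apply: (span_bind (f := fun u => u * v)) => [a f g|].
  by rewrite mulrDl -scalerAl.
move=> _ [l nl ->]; move: v Sv.
apply: (span_bind (f := fun v => _ * v)) => [a f g|].
  by rewrite mulrDr -scalerAr.
move=> _ [l' nl' ->]; apply: span_gen; exists (l ++ l').
  by rewrite all_cat nl nl'.
by rewrite /atoms_val big_cat.
Qed.

Lemma raw_bracket u k : span raw_product u -> span raw_product (bracket u (y k)).
Proof.
apply: (span_bind (f := fun u => bracket u (y k))) => [a f g|].
  exact: bracket_linear.
move=> _ [l vl ->]; elim: l vl => [|[h js] l IHl] /= => [_|/andP[vh vl]].
  by rewrite /atoms_val big_nil /bracket mulr1 mul1r subrr; apply: span0.
rewrite /atoms_val big_cons bracketMl; apply: spanD; apply: raw_spanM.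
- have -> : bracket (aval (h, js)) (y k) = aval (h, rcons js k).
    by rewrite /atom_val /= map_rcons -cats1 lbracket_cat.
  exact: raw_atom.
- by apply: span_gen; exists l.
- exact: raw_atom.
- exact: IHl.
Qed.

Lemma raw_normal u : span raw_product u -> exists w, span (normal_product w) u.
Proof.
elim=> [|a f g [l vl ->] _ [w2 S2]]; first by exists 0%N; apply: span0.
have [w1 S1] : exists w, span (normal_product w) (atoms_val x q l).
  exists (sumn (map (weight q) l)); elim: l vl => [_|c l IHl /= /andP[vc vl]].
    by apply: span_gen; exists [::]; rewrite /atoms_val.
  by rewrite /atoms_val big_cons; apply: normal_spanM (IHl vl); apply: atom_normal_span.
exists (w1 + w2)%N; apply: spanDZ; apply: normal_span_mono; try eassumption.
  exact: leq_addr.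
exact: leq_addl.
Qed.

Definition even_raw_product (n : nat) f : Prop := exists m b,
  [/\ (size m <= n)%N, span raw_product b & f = evens_val x m * b].

Lemma evens_cat m m' : evens_val x (m ++ m') = evens_val x m * evens_val x m'.
Proof. exact: big_cat. Qed.

Lemma evens_nseq n k : evens_val x (nseq n k) = y k ^+ n.
Proof. by rewrite /evens_val big_nseq iter_mulr_1. Qed.

(** A product of atoms [b] passes an even variable [t] by
    [b * t = t * b + bracket b t], and the bracket with an even variable only
    adds an entry to an atom. *)
Lemma raw_evens b m : span raw_product b ->
  span (even_raw_product (size m)) (b * evens_val x m).
Proof.
elim: m b => [|k m IH] b Sb.
  apply: span_gen; exists [::], b; split=> //.
  by rewrite /evens_val big_nil mulr1 mul1r.
have -> : b * evens_val x (k :: m) =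
    y k * (b * evens_val x m) + bracket b (y k) * evens_val x m.
  by rewrite /evens_val big_cons /bracket mulrBl !mulrA addrC subrK.
apply: spanD; last first.
  apply: span_mono (IH _ (raw_bracket k Sb)) => _ [m' [b' [sz Sb' ->]]].
  by apply: span_gen; exists m', b'; split=> //; apply: leqW.
apply: (span_bind (f := fun u => y k * u)) (IH b Sb) => [a f g|].
  by rewrite mulrDr -scalerAr.
move=> _ [m' [b' [sz Sb' ->]]]; apply: span_gen; exists (k :: m'), b'.
by split=> //; rewrite mulrA /evens_val big_cons.
Qed.

(** Exchanging two even variables, or replacing [q] equal ones by one, costs
    an atom in the middle of the word; moved to the right, it leaves a shorter
    word of even variables. *)
Lemma even_raw_straight m b : span raw_product b ->
  span straight_product (evens_val x m * b).
Proof.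
move: {2}(size m) (leqnn (size m)) => n; elim/ltn_ind: n m b => n IH m b szm Sb.
have lower p r s : span raw_product r -> (size p + size s < n)%N ->
    span straight_product (evens_val x p * (r * evens_val x s) * b).
  move=> Sr lt.
  apply: (span_bind (f := fun u => _ * u * b)) (raw_evens s Sr) => [a f g|].
    by rewrite mulrDr mulrDl -scalerAr -scalerAl.
  move=> _ [s' [b' [sz Sb' ->]]]; rewrite mulrA -evens_cat -mulrA.
  apply: (IH (size p + size s)%N) => //; last exact: raw_spanM.
  by rewrite size_cat leq_add2l.
have perm m' : perm_eq m m' -> span straight_product (evens_val x m' * b) ->
    span straight_product (evens_val x m * b).
  move=> pe; apply/span_sub.
  apply: (span_perm (E := fun s => evens_val x s * b)) pe szm => p i j s sz.
  rewrite -mulrBl !evens_cat -mulrBr.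
  have -> : evens_val x [:: i, j & s] - evens_val x [:: j, i & s] =
      bracket (y i) (y j) * evens_val x s.
    by rewrite /evens_val !big_cons !mulrA mulrBl.
  apply: lower; first exact: (@raw_atom (Heven G i j, [::])).
  by apply: leq_trans sz; rewrite size_cat /= !addnS ltnS leqnSn.
have [red|/not_reduced[k [q0 /perm_nseq_count[s pe]]]] := boolP (reduced q m).
  apply: perm (perm_sort_leq m) _.
  have [w] := raw_normal Sb.
  apply: (span_bind (f := fun b => _ * b)) => [a f g|].
    by rewrite mulrDr -scalerAr.
  move=> _ [l [nl _ ->]]; apply: span_gen; exists (sort leq m), l.
  by rewrite sort_leq_sorted -(perm_reduced _ (perm_sort_leq m)).
apply: (perm _ pe); rewrite evens_cat evens_nseq.
rewrite -[y k ^+ q](subrK (y k)) mulrDl mulrDl.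
move: szm; rewrite (perm_size pe) size_cat size_nseq => szm.
have q1 := field_size_gt1 q0; apply: spanD.
  have := lower [::] _ s (@raw_atom (Hpow G k, [::]) q0).
  rewrite {1}/evens_val big_nil mul1r; apply.
  by rewrite (leq_trans _ szm) // -[ltnLHS]add0n ltn_add2r ltnW.
have -> : y k * evens_val x s = evens_val x (k :: s) by rewrite /evens_val big_cons.
apply: (IH (size (k :: s))) => //; apply: leq_trans szm.
by rewrite /= -[(size s).+1]add1n ltn_add2r.
Qed.

(** Reading a word from the left, an odd variable is a new atom and an even one
    is moved past the atoms collected so far. *)
Lemma word_straight (s : seq (G * nat)) :
  span straight_product (\prod_(k <- s) x k).
Proof.
suff [n Sn] : exists n, span (even_raw_product n) (\prod_(k <- s) x k).
  apply: span_mono Sn => _ [m [b [_ Sb ->]]]; exact: even_raw_straight.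
elim/last_ind: s => [|s [g i] [n IH]].
  exists 0%N; apply: span_gen; exists [::], 1; rewrite /evens_val !big_nil mulr1.
  by split=> //; apply: raw_one.
exists n.+1; rewrite -cats1 big_cat big_seq1 /=.
apply: (span_bind (f := fun u => u * x (g, i))) IH => [a f f'|].
  by rewrite mulrDl -scalerAl.
move=> _ [m [b [sz Sb ->]]]; have [->|g1] := eqVneq g 1%g; last first.
  apply: span_gen; exists m, (b * x (g, i)); rewrite mulrA leqW //; split=> //.
  by apply: raw_spanM Sb _; apply: (@raw_atom (Hodd g i, [::])).
have -> : evens_val x m * b * x (1%g, i) =
    evens_val x (rcons m i) * b + evens_val x m * bracket b (y i).
  rewrite -cats1 evens_cat [evens_val x [:: i]]big_seq1 -!mulrA -mulrDr.
  by rewrite /bracket addrC subrK.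
apply: spanD; apply: span_gen.
  by exists (rcons m i), b; rewrite size_rcons ltnS.
by exists m, (bracket b (y i)); split=> //; [apply: leqW | apply: raw_bracket].
Qed.

End Straightening.

(** * Entries of matrices and graded identities *)

Section Entries.
Variable F : fieldType.
Implicit Types (u v : UT1 F) (i j : nat).

Definition ut_coef i j (x : UT F) : F := oapp (fun k => x@_k) 0 (insub (i, j)).

Lemma ut_coef_linear i j a (x x' : UT F) :
  ut_coef i j (a *: x + x') = a * ut_coef i j x + ut_coef i j x'.
Proof.
rewrite /ut_coef; case: insub => [k|] /=; last by rewrite mulr0 addr0.
by rewrite mcoeffD mcoeffZ.
Qed.

Lemma ut_coef0 i j : ut_coef i j 0 = 0.
Proof.
by have := ut_coef_linear i j (-1) 0 0; rewrite scaleN1r addNr mulN1r addNr.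
Qed.

Lemma ut_coef_at i j k l : (k <= l)%N ->
  ut_coef i j (munit_at F k l) = ((k == i) && (l == j))%:R.
Proof.
move=> le; rewrite /munit_at insubT /= munit.unlock /ut_coef.
case: insubP => [m _ vm|ngt] /=; last first.
  case: eqP => // ki; case: eqP => // lj; by rewrite -ki -lj le in ngt.
by rewrite mcoeffU -val_eqE vm /= xpair_eqE.
Qed.

Lemma ut_coef_lt i j (x : UT F) : (j < i)%N -> ut_coef i j x = 0.
Proof. by move=> lt; rewrite /ut_coef insubF //= leqNgt lt. Qed.

Lemma ut_eq0 (x : UT F) : (forall i j, ut_coef i j x = 0) -> x = 0.
Proof.
move=> x0; apply/malgP => k; rewrite mcoeff0; have := x0 (val k).1 (val k).2.
by rewrite /ut_coef -surjective_pairing valK.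
Qed.

Lemma ut_homogP (G : groupType) (eps : nat -> G) g (x : UT F) :
  ut_homog eps g x <->
  forall i j, ut_coef i j x != 0 -> (\prod_(i <= k < j) eps k)%g = g.
Proof.
split=> [h i j|h k]; last first.
  rewrite -mcoeff_neq0 => k0; apply: h.
  by rewrite /ut_coef -surjective_pairing valK.
rewrite /ut_coef; case: insubP => [k _ vk|_] /=; last by rewrite eqxx.
by rewrite mcoeff_neq0 => /h <-; rewrite /unit_deg vk.
Qed.

(** The entry of a matrix of the unitization, seen as the algebra of upper
    triangular matrices that are eventually scalar. *)
Definition entry i j u : F := (i == j)%:R * scalar_part u + ut_coef i j (ut_part u).

Lemma entry_linear i j a u v : entry i j (a *: u + v) = a * entry i j u + entry i j v.
Proof.
rewrite /entry /= mulrDr mulrDr ut_coef_linear addrACA; congr (_ + _ + _).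
by rewrite mulrCA.
Qed.

Lemma entry0 i j : entry i j 0 = 0.
Proof. by have := entry_linear i j (-1) 0 0; rewrite scaleN1r addNr mulN1r addNr. Qed.

Lemma entry1 i j : entry i j 1 = (i == j)%:R.
Proof.
by rewrite /entry [scalar_part _]/= [ut_part _]/= ut_coef0 mulr1 addr0.
Qed.

Lemma entry_ut i j (x : UT F) : entry i j (to_ut1 x) = ut_coef i j x.
Proof. by rewrite /entry mulr0 add0r. Qed.

Lemma entry_lt i j u : (j < i)%N -> entry i j u = 0.
Proof. by move=> lt; rewrite /entry ut_coef_lt // (gtn_eqF lt) mul0r addr0. Qed.

Lemma scalar_partZ a u : scalar_part (a *: u) = a * scalar_part u.
Proof. by []. Qed.

Lemma ut_partZ a u : ut_part (a *: u) = a *: ut_part u.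
Proof. by []. Qed.

Lemma ut1_scalerAl a u v : (a *: u) * v = a *: (u * v).
Proof.
apply: ut1_eq; first by rewrite scalar_partZ !scalar_partM mulrA.
rewrite ut_partZ !ut_partM ut_partZ scalar_partZ ut_mulZl !scalerDr !scalerA.
by rewrite [scalar_part v * a]mulrC.
Qed.

Lemma ut1_scalerAr a u v : u * (a *: v) = a *: (u * v).
Proof.
apply: ut1_eq; first by rewrite scalar_partZ !scalar_partM scalar_partZ mulrCA.
rewrite ut_partZ !ut_partM ut_partZ scalar_partZ ut_mulZr !scalerDr !scalerA.
by rewrite [scalar_part u * a]mulrC.
Qed.

Lemma ut1_ind (P : UT1 F -> Prop) :
  (forall a u v, P u -> P v -> P (a *: u + v)) ->
  P 1 -> (forall i j, (i <= j)%N -> P (to_ut1 (munit_at F i j))) -> forall u, P u.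
Proof.
move=> PD P1 PE; have P0 : P 0 by have := PD (-1) 1 1 P1 P1; rewrite scaleN1r addNr.
case=> s x; have -> : (s, x) = (s : F) *: (1 : UT1 F) + to_ut1 x :> UT1 F.
  apply: ut1_eq.
    rewrite scalar_partD scalar_partZ [scalar_part 1]/(1 : F) mulr1.
    by rewrite [scalar_part (to_ut1 _)]/(0 : F) addr0.
  by rewrite ut_partD ut_partZ [ut_part 1]/(0 : UT F) scaler0 add0r.
apply: (PD) => //; rewrite (malg_expand x).
elim: (enum_fset (msupp x)) => [|k l IH]; first by rewrite big_nil.
rewrite big_cons; have -> (z : UT F) : to_ut1 (x@_k *: << k >> + z) =
    x@_k *: to_ut1 (munit_at F (val k).1 (val k).2) + to_ut1 z.
  rewrite munit_at_val munit.unlock.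
  apply: ut1_eq; last by rewrite ut_partD ut_partZ.
  by rewrite scalar_partD scalar_partZ ![scalar_part (to_ut1 _)]/(0 : F) mulr0 addr0.
by apply: PD IH; apply: PE; apply: (valP k).
Qed.

Lemma to_ut1M (x x' : UT F) : to_ut1 x * to_ut1 x' = to_ut1 (ut_mul x x').
Proof.
apply: ut1_eq; first exact: mul0r.
by rewrite [LHS]ut_partM !scale0r !add0r.
Qed.

Lemma entryM i j u v :
  entry i j (u * v) = \sum_(i <= k < j.+1) entry i k u * entry k j v.
Proof.
have [ltji|leij] := ltnP j i; first by rewrite entry_lt // big_geq.
have pick k (f : nat -> F) : (i <= k <= j)%N ->
    \sum_(i <= m < j.+1) (k == m)%:R * f m = f k.
  move=> /andP[le1 le2]; rewrite (bigD1_seq k) ?mem_index_iota ?le1 ?iota_uniq //=.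
  rewrite eqxx mul1r big1 ?addr0 // => m mk.
  by rewrite eq_sym (negPf mk) mul0r.
elim/ut1_ind: u => [a u u' IH IH'| |k l lekl].
- rewrite mulrDl ut1_scalerAl entry_linear IH IH' mulr_sumr -big_split.
  by apply: eq_bigr => m _ /=; rewrite entry_linear [RHS]mulrDl mulrA.
- rewrite mul1r -(pick i (fun m => entry m j v)) ?leqnn //.
  by apply: eq_bigr => m _; rewrite entry1.
transitivity ((k == i)%:R * entry l j v).
  elim/ut1_ind: v => [a u u' IH IH'| |k' l' lekl'].
  - by rewrite mulrDr ut1_scalerAr !entry_linear IH IH' [RHS]mulrDr mulrCA.
  - by rewrite mulr1 entry_ut ut_coef_at // entry1 -natrM mulnb.
  rewrite to_ut1M ut_mul_at // !entry_ut ut_coef_at // -natrM mulnb.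
  have [lk|_] := eqVneq l k'; last by rewrite andbF ut_coef0.
  by rewrite ut_coef_at // (leq_trans lekl) // lk.
under eq_bigr => m _ do rewrite entry_ut ut_coef_at // -mulnb natrM -mulrA.
rewrite -mulr_sumr; have [ki|_] := eqVneq k i; last by rewrite !mul0r.
congr (_ * _); have [lelj|ltjl] := leqP l j.
  by rewrite pick // -ki lekl.
rewrite entry_lt // big_nat_cond big1 // => m /andP[/andP[_ ltm] _].
by rewrite gtn_eqF ?mul0r // (leq_trans ltm).
Qed.

Lemma ut1_eq0 u : (forall i j, entry i j u = 0) -> u = 0.
Proof.
move=> u0; have diag i : scalar_part u + ut_coef i i (ut_part u) = 0.
  by have := u0 i i; rewrite /entry eqxx mul1r.
have s0 : scalar_part u = 0.
  (* A finitely supported matrix has a zero on its diagonal. *)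
  pose n := \max_(k <- enum_fset (msupp (ut_part u))) (val k).1.+1.
  have := diag n; suff -> : ut_coef n n (ut_part u) = 0 by rewrite addr0.
  rewrite /ut_coef; case: insubP => //= k _ vk; apply/mcoeff_outdom/negP => kin.
  have := leq_bigmax_seq k (F := fun k : matrix_unit => (val k).1.+1) kin isT.
  by rewrite -/n /= (congr1 fst vk) ltnn.
apply: ut1_eq => //; apply: ut_eq0 => i j.
by have := u0 i j; rewrite /entry s0 mulr0 add0r.
Qed.

End Entries.

Section MatrixModels.
Variables (F : fieldType) (G : groupType) (eps : nat -> G).
Local Notation A := (freeAlg F G).

Definition deg_between (i j : nat) : G := (\prod_(i <= k < j) eps k)%g.

(** The homogeneous upper triangular matrices of the algebra of matrices with
    rows and columns in the range of [iota]. *)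
Definition mx_homog n (iota : 'I_n.+1 -> nat) (g : G) (B : 'M[F]_n.+1) : Prop :=
  forall i j, B i j != 0 -> (i <= j)%N /\ deg_between (iota i) (iota j) = g.

Definition increasing n (iota : 'I_n -> nat) : Prop :=
  forall i j : 'I_n, (iota i < iota j)%N = (i < j)%N.

Section Compression.
Variables (n : nat) (iota : 'I_n.+1 -> nat).
Hypothesis incr : increasing iota.
Variables (a : G * nat -> UT F) (b : G * nat -> 'M[F]_n.+1).
Hypothesis ab : forall x (i : 'I_n.+1) j, (j <= iota ord_max)%N ->
  ut_coef (iota i) j (a x) = \sum_k (iota k == j)%:R * b x i k.
Hypothesis b_upper : forall x (i j : 'I_n.+1), b x i j != 0 -> (i <= j)%N.

Lemma increasing_inj : injective iota.
Proof.
move=> i j e; apply/val_inj/eqP; rewrite eqn_leq.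
by rewrite [(i <= j)%N]leqNgt [(j <= i)%N]leqNgt -!incr e ltnn.
Qed.

(** Multiplication of the entries in the rows and columns of the range of
    [iota] stays inside the range if the matrices have no entry in a row of the
    range and in a column that precedes the end of the range but is out of it.
    This covers both the matrices supported on the range and the initial squares
    of arbitrary upper triangular matrices. *)
Lemma compression (f : A) i j : entry (iota i) (iota j) (eval a f) = fmorph b f i j.
Proof.
elim/free_linear_ind: f => [|c f g IHf IHg|w].
- by rewrite linear0 raddf0 entry0 mxE.
- by rewrite eval_is_linear fmorph_is_linear entry_linear IHf IHg !mxE.
rewrite fmorph_monom /eval lin_extU; move: i.
elim: (w : seq _) => [|x s IH] i.
  by rewrite !big_nil entry1 mxE (inj_eq increasing_inj).
rewrite !big_cons entryM mxE.
have -> : \sum_(iota i <= k < (iota j).+1)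
    entry (iota i) k (to_ut1 (a x)) * entry k (iota j) (\prod_(y <- s) to_ut1 (a y)) =
  \sum_(iota i <= k < (iota j).+1) \sum_m (iota m == k)%:R *
    (b x i m * (\prod_(y <- s) b y) m j).
  apply: eq_big_nat => k /andP[_ ltk]; rewrite entry_ut ab; last first.
    by rewrite -ltnS (leq_trans ltk) // ltnS leqNgt incr -leqNgt leq_ord.
  rewrite mulr_suml; apply: eq_bigr => m _; have [<-|_] := eqVneq; last by rewrite !mul0r.
  by rewrite !mul1r IH.
rewrite exchange_big; apply: eq_bigr => m _ /=; rewrite -mulr_suml.
have [/andP[le1 le2]|out] := boolP (iota i <= iota m <= iota j)%N.
  rewrite (bigD1_seq (iota m)) ?mem_index_iota ?le1 ?iota_uniq //= eqxx big1 ?addr0 ?mul1r //.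
  by move=> k mk; rewrite eq_sym (negPf mk).
have [->|b0] := eqVneq (b x i m) 0; first by rewrite mul0r mulr0.
have leim : (iota i <= iota m)%N by rewrite leqNgt incr -leqNgt (b_upper b0).
rewrite -IH entry_lt ?mulr0 //.
by rewrite ltnNge; apply: contra out => ->; rewrite leim.
Qed.

End Compression.

(** A matrix over the range of [iota], filled up with zeros, lies in [UT]. *)
Lemma identity_mx n (iota : 'I_n.+1 -> nat) b (f : A) : increasing iota ->
  (forall x, mx_homog iota x.1 (b x)) -> f \in IdG eps -> fmorph b f = 0.
Proof.
move=> incr bh /asboolP If.
pose a x : UT F := \sum_(i < n.+1) \sum_(k < n.+1 | (i <= k)%N)
  b x i k *: munit_at F (iota i) (iota k).
have le_iota (i k : 'I_n.+1) : (i <= k)%N -> (iota i <= iota k)%N.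
  by move=> le; rewrite leqNgt incr -leqNgt.
have coef x i j : ut_coef i j (a x) =
    \sum_i' \sum_k ((iota i' == i) && (iota k == j))%:R * b x i' k.
  have addm : {morph @ut_coef F i j : u v / u + v}.
    by move=> u v; have := ut_coef_linear i j 1 u v; rewrite scale1r mul1r.
  rewrite (big_morph _ addm (ut_coef0 F i j)); apply: eq_bigr => i' _.
  rewrite (big_morph _ addm (ut_coef0 F i j)) big_mkcond; apply: eq_bigr => k _.
  case: ifP => leik.
    have := ut_coef_linear i j (b x i' k) (munit_at F (iota i') (iota k)) 0.
    by rewrite addr0 ut_coef0 addr0 ut_coef_at ?le_iota // mulrC => ->.
  have [->|/bh[]] := eqVneq (b x i' k) 0; first by rewrite mulr0.
  by rewrite leik.
have bu x i j : b x i j != 0 -> (i <= j)%N by move=> /bh[].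
apply/matrixP => i j; rewrite mxE -(compression incr (a := a)) //.
- rewrite If ?entry0 // => x; apply/ut_homogP => i' j'; rewrite coef.
  move=> nz; have [i1 [k1 []]] : exists i k, [/\ iota i = i', iota k = j' & b x i k != 0].
    apply: contrapT => no; case/eqP: nz; rewrite big1 // => i1 _; rewrite big1 // => k1 _.
    have [e1|_] := eqVneq; last by rewrite mul0r.
    have [e2|_] := eqVneq; last by rewrite mul0r.
    have [->|nz] := eqVneq (b x i1 k1) 0; first by rewrite mulr0.
    by case: no; exists i1, k1.
  by move=> <- <- /bh[].
- move=> x i' j' _; rewrite coef (bigD1 i') //= [X in _ + X]big1 ?addr0.
    by apply: eq_bigr => k _; rewrite eqxx.
  move=> i1 ne; rewrite big1 // => k _; rewrite (inj_eq (increasing_inj incr)).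
  by rewrite (negPf ne) mul0r.
Qed.

(** Each entry of an evaluation is read off in an initial square. *)
Lemma mx_identity (f : A) :
  (forall n (b : G * nat -> 'M[F]_n.+1),
     (forall x, mx_homog (@nat_of_ord n.+1) x.1 (b x)) -> fmorph b f = 0) ->
  f \in IdG eps.
Proof.
move=> h; apply/asboolP => a ah; apply: ut1_eq0 => i j.
pose n := maxn i j; pose b x : 'M[F]_n.+1 := \matrix_(k, l) ut_coef k l (a x).
have incr : increasing (@nat_of_ord n.+1) by [].
have bu x (k l : 'I_n.+1) : b x k l != 0 -> (k <= l)%N.
  by rewrite mxE leqNgt; apply: contra => lt; rewrite ut_coef_lt.
have ltin : (i < n.+1)%N by rewrite ltnS leq_maxl.
have ltjn : (j < n.+1)%N by rewrite ltnS leq_maxr.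
rewrite -[i]/(nat_of_ord (Ordinal ltin)) -[j]/(nat_of_ord (Ordinal ltjn)).
rewrite (compression incr (b := b)) //.
  rewrite h ?mxE // => x k l bn; split; first exact: bu bn.
  by move: bn; rewrite mxE => /(proj1 (ut_homogP eps _ _) (ah x)).
move=> x k l /= len; have ltl : (l < n.+1)%N by rewrite ltnS.
rewrite (bigD1 (Ordinal ltl)) //= eqxx mul1r mxE big1 ?addr0 // => m ml.
by rewrite -[l]/(nat_of_ord (Ordinal ltl)) (inj_eq val_inj) (negPf ml) mul0r.
Qed.

End MatrixModels.

(** * Good sequences as walks *)

Section Walks.
Variables (F : fieldType) (G : groupType) (eps : nat -> G).
Local Notation dg := (deg_between eps).
Implicit Types (i j : nat) (t : seq nat) (eta : seq G).

(** The positions visited by a product of matrix units in the radical: each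
    unit leads from one entry of [i :: t] to the next one. *)
Definition walk eta i t : Prop := path ltn i t /\ pairmap dg i t = eta.

Lemma deg_between_id i : dg i i = 1%g.
Proof. by rewrite /deg_between big_geq. Qed.

Lemma deg_betweenM i j k : (i <= j)%N -> (j <= k)%N -> (dg i j * dg j k)%g = dg i k.
Proof. by move=> le1 le2; rewrite /deg_between -big_cat_nat. Qed.

Lemma walk_units i t : path ltn i t -> exists r : seq matrix_unit,
  [/\ all in_radical r, map (unit_deg eps) r = pairmap dg i t
    & forall h, (h <= i)%N -> to_ut1 (munit_at F h i) * \prod_(k <- r) to_ut1 (munit F k)
        = to_ut1 (munit_at F h (last i t))].
Proof.
elim: t i => [|j t IH] i /=.
  by exists [::]; split=> // h _; rewrite big_nil mulr1.
case/andP=> ltij /IH[r [rad deg prod]].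
pose k : matrix_unit := exist _ (i, j) (ltnW ltij).
exists (k :: r); split=> /=.
- by rewrite rad /in_radical /= ltij.
- by rewrite deg.
- move=> h lehi; rewrite big_cons mulrA -(munit_at_val F k) to_ut1M /=.
  rewrite ut_mul_at ?(ltnW ltij) // eqxx prod //.
  exact: leq_trans lehi (ltnW ltij).
Qed.

Lemma munit_at_neq0 i j : (i <= j)%N -> munit_at F i j != 0.
Proof.
move=> leij; apply/eqP => /(congr1 (ut_coef i j)).
by rewrite ut_coef_at // ut_coef0 !eqxx => /eqP; rewrite oner_eq0.
Qed.

Lemma to_ut1_eq0 (u : UT F) : (to_ut1 u == 0) = (u == 0).
Proof. by rewrite -[RHS]andTb -[true in RHS](eqxx (0 : F)). Qed.

Lemma path_ltn_last i t : path ltn i t -> (i <= last i t)%N.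
Proof.
elim: t i => //= j t IH i /andP[ltij pt].
exact: leq_trans (ltnW ltij) (IH _ pt).
Qed.

(** A product of matrix units is nonzero exactly if each begins where the
    preceding one ends. *)
Lemma goodP eta : good eps F eta <-> exists i t, walk eta i t.
Proof.
split=> [[r [rad nz <-]]|[i [t [pt <-]]]]; last first.
  have [r [rad deg prod]] := walk_units pt.
  exists r; split=> //; apply/eqP => P0; have := prod i (leqnn i).
  move=> /esym/eqP; rewrite P0 mulr0 to_ut1_eq0; apply/negP.
  exact/munit_at_neq0/path_ltn_last.
pose start (r : seq matrix_unit) := head 0%N [seq (val k).1 | k <- r].
exists (start r); elim: r rad nz => [|k r IH] /= => [_ _|/andP[radk rad]].
  by exists [::].
rewrite big_cons => nz.
have [|t [pt deg]] := IH rad.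
  by apply: contra nz => /eqP ->; rewrite mulr0.
exists ((val k).2 :: t).
case: r rad nz pt deg {IH} => [|l r] rad nz pt deg.
  case: t pt deg => // _ _; split; rewrite /= ?andbT //.
have kl : (val k).2 = (val l).1.
  move: nz; rewrite big_cons mulrA to_ut1M ut_mulEE /munit_mul.
  by have [//|_] := eqVneq (val k).2; rewrite -[to_ut1 0]/(0 : UT1 F) mul0r eqxx.
split; first by rewrite /= -[X in X && _]/(in_radical k) radk kl.
by rewrite /= -[LHS]/(unit_deg eps k :: _) kl deg.
Qed.

End Walks.

(** * Homogeneous polynomials and matrices *)

Section Homogeneous.
Variables (F : fieldType) (G : groupType).
Local Notation A := (freeAlg F G).
Implicit Types (f h : A) (g : G) (w : {fmonom (G * nat)%type}).

Lemma homogP g f :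
  homog g f <-> span (fun u : A => exists2 w, word_deg w = g & u = monom F w) f.
Proof.
split=> [hf|].
  rewrite (malg_expand f); have: all (fun w => w \in msupp f) (enum_fset (msupp f)).
    by apply/allP.
  elim: (enum_fset (msupp f)) => [|w s IH] /= => [_|/andP[wf sf]].
    by rewrite big_nil; apply: span0.
  by rewrite big_cons; apply: span_cons (IH sf); exists w; first exact: hf.
elim=> [w|a u v [w0 dw0 ->] _ IH w]; first by rewrite msupp0.
rewrite -mcoeff_neq0 mcoeffD mcoeffZ mcoeffU1.
have [<- //|_] := eqVneq w0 w; rewrite mulr0 add0r mcoeff_neq0; exact: IH.
Qed.

Lemma homog0 g : homog g (0 : A).
Proof. by apply/homogP/span0. Qed.

Lemma homogB g f h : homog g f -> homog g h -> homog g (f - h).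
Proof. by move=> /homogP Sf /homogP Sh; apply/homogP/spanB. Qed.

Lemma homog_monom w : homog (word_deg w) (monom F w).
Proof. by apply/homogP/span_gen; exists w. Qed.

Lemma homog_xvar g i : homog g (xvar F g i).
Proof.
rewrite (xvarE F (g, i)).
by have := @homog_monom (fmu (g, i)); rewrite /word_deg fmU big_seq1.
Qed.

Lemma homog1 : homog 1%g (1 : A).
Proof.
have -> : (1 : A) = monom F mone by [].
by have := @homog_monom mone; rewrite /word_deg fm1 big_nil.
Qed.

Lemma homogM g g' f h : homog g f -> homog g' h -> homog (g * g')%g (f * h).
Proof.
move=> /homogP Sf /homogP Sh; apply/homogP; move: f Sf.
apply: (span_bind (f := fun u : A => u * h)) => [a u v|_ [w <- ->]].
  by rewrite mulrDl -scalerAl.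
apply: (span_bind (f := fun u : A => _ * u)) Sh => [a u v|_ [w' <- ->]].
  by rewrite mulrDr -scalerAr.
apply: span_gen; exists (mmul w w'); last exact: monomM.
by rewrite /word_deg fmM big_cat.
Qed.

Lemma homogX n f : homog 1%g f -> homog 1%g (f ^+ n).
Proof.
move=> hf; elim: n => [|n IH]; first exact: homog1.
by rewrite exprS -[1%g]mulg1; apply: homogM.
Qed.

Lemma homog_bracket g f h : homog g f -> homog 1%g h -> homog g (bracket f h).
Proof.
by move=> hf hh; apply: homogB; [rewrite -[g]mulg1 | rewrite -[g]mul1g]; apply: homogM.
Qed.

Lemma homog_lbracket g f (js : seq nat) :
  homog g f -> homog g (lbracket f (map (@yvar F G) js)).
Proof.
elim: js f => //= j js IH f hf; apply/IH/homog_bracket => //; exact: homog_xvar.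
Qed.

Lemma homog_uniq g g' f : f != 0 -> homog g f -> homog g' f -> g = g'.
Proof.
move=> f0 hf hf'; have [w wf] : exists w, w \in msupp f.
  by apply/fset0Pn; rewrite msupp_eq0.
by rewrite -(hf w wf) (hf' w wf).
Qed.

(** A degree-preserving endomorphism is any substitution of homogeneous
    elements of the right degrees. *)
Lemma fmorph_homog (s : G * nat -> A) : (forall x, homog x.1 (s x)) ->
  forall g f, homog g f -> homog g (fmorph s f).
Proof.
move=> hs g f /homogP Sf; apply/homogP; apply: span_bind Sf => [a u v|].
  exact: fmorph_is_linear.
move=> _ [w <- ->]; rewrite fmorph_monom; apply/homogP.
rewrite /word_deg; elim: (w : seq _) => [|x r IH].
  by rewrite !big_nil; apply: homog1.
by rewrite !big_cons; apply: homogM.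
Qed.

Definition genx (x : G * nat) : A := xvar F x.1 x.2.

Definition head_deg (h : atom_head G) : G := if h is Hodd g _ then g else 1%g.

Lemma homog_head q (d : atom_head G) : homog (head_deg d) (head_val genx q d).
Proof.
case: d => [g i|i j|i] /=; first exact: homog_xvar.
  by apply: homog_bracket; apply: homog_xvar.
by apply: homogB; [apply: homogX|]; apply: homog_xvar.
Qed.

Lemma homog_atom q c : homog (head_deg c.1) (atom_val genx q c).
Proof. exact/homog_lbracket/homog_head. Qed.

End Homogeneous.

Section MatrixEvaluation.
Variables (F : fieldType) (G : groupType) (eps : nat -> G).
Local Notation A := (freeAlg F G).
Local Notation dg := (deg_between eps).
Variables (n : nat) (iota : 'I_n.+1 -> nat).
Hypothesis incr : increasing iota.
Local Notation mxh := (mx_homog eps iota).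
Implicit Types (B C : 'M[F]_n.+1) (g : G).

Lemma mx_homog_linear g a B C : mxh g B -> mxh g C -> mxh g (a *: B + C).
Proof.
move=> hB hC i j; rewrite !mxE; have [->|/hB //] := eqVneq (B i j) 0.
by rewrite mulr0 add0r => /hC.
Qed.

Lemma mx_homog1 : mxh 1%g (1 : 'M[F]_n.+1).
Proof.
move=> i j; rewrite mxE; have [-> _|_] := eqVneq i j; last by rewrite eqxx.
by rewrite deg_between_id.
Qed.

Lemma mx_homogM g h B C : mxh g B -> mxh h C -> mxh (g * h)%g (B * C).
Proof.
move=> hB hC i j; rewrite mxE => nz.
have [k [/hB[leik <-] /hC[lekj <-]]] : exists k, B i k != 0 /\ C k j != 0.
  apply: contrapT => no; case/eqP: nz; apply: big1 => k _; apply/eqP.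
  by rewrite mulf_eq0; apply: contrapT => /negP; rewrite negb_or => /andP[? ?];
    apply: no; exists k.
have le (i' j' : 'I_n.+1) : (i' <= j')%N -> (iota i' <= iota j')%N.
  by move=> le; rewrite leqNgt incr -leqNgt.
by rewrite (leq_trans leik) // deg_betweenM ?le.
Qed.

Lemma mx_homog_fmorph b (f : A) g :
  (forall x, mxh x.1 (b x)) -> homog g f -> mxh g (fmorph b f).
Proof.
move=> hb /homogP; elim=> [|a u v [w <- ->] _ IH].
  by rewrite raddf0 => i j; rewrite mxE eqxx.
rewrite fmorph_is_linear; apply: mx_homog_linear IH; rewrite fmorph_monom.
rewrite /word_deg; elim: (w : seq _) => [|x r IHr].
  by rewrite !big_nil; apply: mx_homog1.
by rewrite !big_cons; apply: mx_homogM.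
Qed.

Definition upper B := forall i j, B i j != 0 -> (i <= j)%N.

Lemma upperM B C : upper B -> upper C -> upper (B * C).
Proof.
move=> uB uC i j; rewrite mxE => nz.
have [k [/uB le1 /uC le2]] : exists k, B i k != 0 /\ C k j != 0.
  apply: contrapT => no; case/eqP: nz; apply: big1 => k _; apply/eqP.
  by rewrite mulf_eq0; apply: contrapT => /negP; rewrite negb_or => /andP[? ?];
    apply: no; exists k.
exact: leq_trans le2.
Qed.

End MatrixEvaluation.

(** * Products of bad degree are identities *)

Section UpperEntries.
Variables (F : fieldType) (n : nat).
Implicit Types (B C : 'M[F]_n.+1) (i j : 'I_n.+1).

Lemma upper_lt B i j : upper B -> (j < i)%N -> B i j = 0.
Proof. by move=> uB lt; apply: contraTeq lt => /uB; rewrite -leqNgt. Qed.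

Lemma sub_mxE B C i j : (B - C) i j = B i j - C i j.
Proof. by rewrite !mxE. Qed.

Lemma upper1 : upper (1 : 'M[F]_n.+1).
Proof. by move=> i j; rewrite mxE; have [->|_] := eqVneq i j; rewrite ?eqxx. Qed.

Lemma upperX B k : upper B -> upper (B ^+ k).
Proof.
by move=> uB; elim: k => [|k IH]; [exact: upper1 | rewrite exprS; apply: upperM].
Qed.

Lemma upperB B C : upper B -> upper C -> upper (B - C).
Proof.
move=> uB uC i j; rewrite !mxE; have [->|/uB //] := eqVneq (B i j) 0.
by rewrite sub0r oppr_eq0 => /uC.
Qed.

Lemma diagM B C i : upper B -> upper C -> (B * C) i i = B i i * C i i.
Proof.
move=> uB uC; rewrite mxE (bigD1 i) //= big1 ?addr0 // => k ki.
have [lt|le] := ltnP k i; first by rewrite (upper_lt uB) // mul0r.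
by rewrite (upper_lt uC) ?mulr0 // ltn_neqAle eq_sym ki.
Qed.

Lemma diagX B k i : upper B -> (B ^+ k) i i = B i i ^+ k.
Proof.
move=> uB; elim: k => [|k IH]; first by rewrite mxE eqxx.
by rewrite !exprS diagM ?IH //; apply: upperX.
Qed.

Lemma diag_bracket B C i : upper B -> upper C -> (bracket B C) i i = 0.
Proof. by move=> uB uC; rewrite /bracket sub_mxE !diagM // mulrC subrr. Qed.

End UpperEntries.

Section FmorphComm.
Variables (F : fieldType) (G : groupType) (R : algType F) (b : G * nat -> R).
Local Notation A := (freeAlg F G).

Lemma fmorph_yvar i : fmorph b (yvar F G i) = b (1%g, i).
Proof. exact: fmorph_xvar. Qed.

Lemma fmorph_comm (u v : A) : fmorph b (comm u v) = bracket (fmorph b u) (fmorph b v).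
Proof.
rewrite -[comm u v]/(u * v - v * u) (raddfB (fmorph b)).
by congr (_ - _); apply: fmorphM.
Qed.

Lemma fmorph_pow k (u v : A) :
  fmorph b (u ^+ k - v) = fmorph b u ^+ k - fmorph b v.
Proof.
by rewrite (raddfB (fmorph b)); congr (_ - _); apply: (rmorphXn (fmorph b)).
Qed.

End FmorphComm.

Section BadProducts.
Variables (F : fieldType) (G : groupType) (eps : nat -> G).
Local Notation A := (freeAlg F G).
Local Notation dg := (deg_between eps).

Lemma idnat_increasing n : increasing (@nat_of_ord n).
Proof. by []. Qed.

(** Graded identities of [UT] are those of all finite initial squares. These
    contain the identity matrix, as [UT] does not. *)
Lemma IdGP (f : A) : f \in IdG eps <-> forall n (b : G * nat -> 'M[F]_n.+1),
  (forall x, mx_homog eps (@nat_of_ord n.+1) x.1 (b x)) -> fmorph b f = 0.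
Proof.
split=> [If n b hb|]; last exact: mx_identity.
exact: identity_mx (@idnat_increasing _) hb If.
Qed.

(** A nonzero entry of a product picks out a walk, one step per factor. *)
Lemma strict_prod_walk n (s : seq (G * 'M[F]_n.+1)) :
  (forall p (i j : 'I_n.+1), p \in s -> p.2 i j != 0 -> (i < j)%N /\ dg i j = p.1) ->
  forall i j : 'I_n.+1, (\prod_(p <- s) p.2) i j != 0 ->
  exists t, walk eps (map fst s) i t /\ last (i : nat) t = j.
Proof.
elim: s => [|p s IH] st i j.
  rewrite big_nil mxE; have [-> _|_] := eqVneq i j; last by rewrite eqxx.
  by exists [::].
rewrite big_cons mxE => nz.
have [k [nzp nzs]] : exists k, p.2 i k != 0 /\ (\prod_(p <- s) p.2) k j != 0.
  apply: contrapT => no; case/eqP: nz; apply: big1 => k _; apply/eqP.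
  by rewrite mulf_eq0; apply: contrapT => /negP; rewrite negb_or => /andP[? ?];
    apply: no; exists k.
have [|t [[pt deg] lt]] := IH _ k j nzs.
  by move=> p' i' j' p's; apply: st; rewrite inE p's orbT.
have [ltik dik] := st p i k (mem_head _ _) nzp.
exists ((k : nat) :: t); split=> //; split; first by rewrite /= ltik.
by rewrite /= deg dik.
Qed.

Lemma identity_factor_diag n (b : G * nat -> 'M[F]_n.+1) k f (i : 'I_n.+1) :
  (forall x, mx_homog eps (@nat_of_ord n.+1) x.1 (b x)) ->
  identity_factor k f -> fmorph b f i i = 0.
Proof.
move=> hb; have ub x : upper (b x) by move=> i' j' /hb[].
case=> [[g g1 ->]|->|[q cq ->]].
- rewrite fmorph_xvar; apply: contra_notP g1 => /eqP /hb[_].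
  by rewrite deg_between_id.
- by rewrite fmorph_comm !fmorph_yvar; apply: diag_bracket.
- rewrite fmorph_pow !fmorph_yvar sub_mxE diagX // (card_field_exp cq).
  exact: subrr.
Qed.

(** The factors take strictly upper triangular values: modulo the strictly
    upper triangular matrices, even values commute and satisfy the equations of
    the field, and odd values vanish. *)
Lemma bad_product_identity f : bad_product eps f -> f \in (IdG eps : pred A).
Proof.
case=> m [c [eta [bad hc fc ->]]]; apply/IdGP => n b hb.
pose s := [seq (tnth eta i, fmorph b (c i)) | i <- index_enum 'I_m].
have -> : fmorph b (\prod_(i < m) c i) = \prod_(p <- s) p.2.
  by rewrite rmorph_prod big_map.
have es : map fst s = eta.
  rewrite -map_comp (eq_map (_ : fst \o _ =1 tnth eta)) //.
  by rewrite /index_enum locked_withE -enumT map_tnth_enum.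
apply/matrixP => i j; rewrite [RHS]mxE; apply: contra_notP bad => /eqP nz.
apply/goodP; have [|t [w _]] := strict_prod_walk _ nz; last first.
  by exists i, t; rewrite -es.
move=> p i' j' /mapP[k _ ->] /= nzk.
have [le deg] := mx_homog_fmorph (@idnat_increasing n.+1) hb (hc k) nzk.
split=> //; rewrite ltn_neqAle le andbT; apply: contraNneq nzk => e.
have -> : j' = i' by apply/val_inj.
by rewrite (identity_factor_diag _ hb (fc k)).
Qed.

(** An endomorphism may add a constant to an even variable. Its composition
    with an evaluation is again one in finite matrices, where constants have
    values of degree 1. *)
Lemma IdG_graded_ideal : graded_ideal (fun f : A => f \in IdG eps).
Proof.
split=> [|phi hphi f /IdGP If].
  split=> [|f g /IdGP If /IdGP Ig|f g h /IdGP If]; apply/IdGP => n b hb.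
  - exact: raddf0.
  - have -> : fmorph b (f + g) = fmorph b f + fmorph b g by apply: raddfD.
    by rewrite If // Ig // addr0.
  - by rewrite !fmorphM If // mulr0 mul0r.
apply/IdGP => n b hb; pose b' x := fmorph b (phi (xvar F x.1 x.2)).
have -> : fmorph b (phi f) = fmorph b' f.
  apply: (eq_lrmorph_free (p := fmorph b \o phi) (q := fmorph b')) => c i.
  exact: (esym (fmorph_xvar b' c i)).
apply: If => x; apply: (mx_homog_fmorph (@idnat_increasing n.+1) hb).
exact/hphi/homog_xvar.
Qed.

End BadProducts.

(** * Products of bad degree follow from the generators *)

Section Substitution.
Variables (F : fieldType) (G : groupType) (eps : nat -> G).
Variables (q : nat) (fq : field_size F q).
Local Notation A := (freeAlg F G).
Local Notation y := (yvar F G).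
Local Notation aval := (atom_val (@genx F G) q).
Implicit Types (c : atom G) (l : seq (atom G)).

(** The generator of the identities of which an atom is a value; [i] is the
    block of variables it uses. *)
Definition generator (i : nat) c : A :=
  match c with
  | (Hodd g _, _) => xvar F g i
  | (Hpow _, [::]) => y (2 * i) ^+ q - y (2 * i)
  | _ => comm (y (2 * i)) (y (2 * i + 1))
  end.

(** With [last_value], the values of the variables of a block that turn the
    generator into the atom: a commutator with even entries is the commutator of
    everything before its last entry with the last entry. *)
Definition main_value c : A :=
  match c with
  | (Heven a b, js) => lbracket (y a) (map y (belast b js))
  | (Hpow a, [::]) => y a
  | (Hpow a, j :: js) => lbracket (y a ^+ q - y a) (map y (belast j js))
  | _ => aval c
  end.

Definition last_value c : A := y (last (if c.1 is Heven _ b then b else 0) c.2).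

Lemma homog_main_value c : homog (head_deg c.1) (main_value c).
Proof.
case: c => [[g i|i j|i] js] /=; first exact: homog_atom.
  exact/homog_lbracket/homog_xvar.
case: js => [|j js]; first exact: homog_xvar.
apply/homog_lbracket/homogB; last exact: homog_xvar.
exact/homogX/homog_xvar.
Qed.

Lemma homog_generator i c : homog (head_deg c.1) (generator i c).
Proof.
have hy k : homog 1%g (y k) by apply: homog_xvar.
have hc j k : homog 1%g (comm (y j) (y k)) by apply: (homog_bracket (hy j) (hy k)).
case: c => [[g k|a b|k] js] /=; [exact: homog_xvar | exact: hc |].
case: js => [|j js]; last exact: hc.
by apply: (homogB _ (hy _)); apply: homogX.
Qed.

Lemma identity_generator i c : valid q c.1 -> identity_factor i (generator i c).
Proof.
case: c => [[g k|a b|k] js] /= v.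
- by apply: Or31; exists g; first exact/eqP.
- exact: Or32.
case: js => [|j js]; last exact: Or32.
by apply: Or33; exists q => //; move: fq v; case: (q).
Qed.

Section Values.
Variable l : seq (atom G).

Definition block_atom (n : nat) : atom G := nth (Heven G 0 0, [::]) l n.

(** The even variables [2 * i] and [2 * i + 1] and the odd variables numbered
    [i] are kept for the [i]th factor. *)
Definition substitution (x : G * nat) : A :=
  if (x.1 == 1%g) && odd x.2 then last_value (block_atom x.2./2)
  else let c := block_atom (if x.1 == 1%g then x.2./2 else x.2) in
       if head_deg c.1 == x.1 then main_value c else 0.

Lemma homog_substitution x : homog x.1 (substitution x).
Proof.
rewrite /substitution; case: ifP => [/andP[/eqP -> _]|_].
  exact: homog_xvar.
move: (block_atom _) => /= c.
case: eqP => [<-|_]; [exact: homog_main_value | exact: homog0].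
Qed.

Lemma substitution_even i : head_deg (block_atom i).1 = 1%g ->
  substitution (1%g, (2 * i)%N) = main_value (block_atom i).
Proof.
move=> d1; rewrite /substitution eqxx /= mul2n odd_double doubleK d1.
by rewrite eqxx.
Qed.

Lemma substitution_odd i :
  substitution (1%g, (2 * i + 1)%N) = last_value (block_atom i).
Proof.
rewrite /substitution eqxx /= mul2n addn1 /= odd_double.
by rewrite uphalf_double.
Qed.

Lemma fmorph_generator i : valid q (block_atom i).1 ->
  fmorph substitution (generator i (block_atom i)) = aval (block_atom i).
Proof.
have Se := @substitution_even i; have So := substitution_odd i.
have Sz g : g != 1%g -> head_deg (block_atom i).1 = g ->
    substitution (g, i) = main_value (block_atom i).
  by move=> g1 d; rewrite /substitution /= (negPf g1) /= d eqxx.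
have step (u : A) j js : lbracket u (map y (j :: js)) =
    bracket (lbracket u (map y (belast j js))) (y (last j js)).
  by rewrite lastI map_rcons -cats1 lbracket_cat.
case: (block_atom i) Se So Sz => [[g k|a b|k] js] /= Se So Sz v.
- by rewrite fmorph_xvar Sz.
- rewrite fmorph_comm !fmorph_yvar Se // So /last_value /=.
  exact: (esym (step _ _ _)).
case: js Se So Sz => [|j js] Se So Sz.
  by rewrite fmorph_pow fmorph_yvar Se.
rewrite fmorph_comm !fmorph_yvar Se // So /last_value /=.
exact: (esym (step _ _ _)).
Qed.

End Values.

Lemma bad_atoms_ideal (I : A -> Prop) l : graded_ideal I ->
  (forall f, bad_product eps f -> I f) -> all (fun c => valid q c.1) l ->
  ~ good eps F (map (fun c => head_deg c.1) l) -> I (atoms_val (@genx F G) q l).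
Proof.
move=> [_ Iphi] Ibad vl bad; pose s := substitution l.
have vi (i : nat) : valid q (block_atom l i).1.
  have [lt|le] := ltnP i (size l); last by rewrite /block_atom nth_default.
  exact: (allP vl _ (mem_nth _ lt)).
have -> : atoms_val (@genx F G) q l =
    fmorph s (\prod_(i < size l) generator i (block_atom l i)).
  rewrite /atoms_val (big_nth (Heven G 0 0, [::])) big_mkord.
  rewrite (rmorph_prod (fmorph s)); apply: eq_bigr => i _.
  exact: (esym (fmorph_generator (vi i))).
apply: (Iphi (fmorph s)) => [g f|]; first exact/fmorph_homog/homog_substitution.
apply: Ibad.
have sz : size (map (fun c => head_deg c.1) l) == size l by rewrite size_map.
exists (size l), (fun i => generator i (block_atom l i)), (Tuple sz); split=> // i.
- rewrite (tnth_nth 1%g) /= (nth_map (Heven G 0 0, [::])) ?ltn_ord //.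
  exact: homog_generator.
- exact: identity_generator.
Qed.

End Substitution.

(** * Linearly independent functions *)

Section Independence.
Variable F : fieldType.

(** Linear independence of a family of functions, for combinations given as
    lists of pairs (coefficient, index) in which an index may be repeated. *)
Definition independent (K : eqType) (X : Type) (D : pred K) (phi : K -> X -> F) : Prop :=
  forall L : seq (F * K), all (fun t => D t.2) L ->
  (forall x, \sum_(t <- L) t.1 * phi t.2 x = 0) ->
  forall k, \sum_(t <- L | t.2 == k) t.1 = 0.

(** With the second point fixed, independence of the first family annihilates
    the coefficient of each of its functions; that coefficient is a combination
    of the second family. *)
Lemma independent_prod (K1 K2 : eqType) (X1 X2 : Type) (D1 : pred K1) (D2 : pred K2)
    (phi1 : K1 -> X1 -> F) (phi2 : K2 -> X2 -> F) :
  independent D1 phi1 -> independent D2 phi2 ->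
  independent (fun k : K1 * K2 => D1 k.1 && D2 k.2)
    (fun k (x : X1 * X2) => phi1 k.1 x.1 * phi2 k.2 x.2).
Proof.
move=> ind1 ind2 L DL e [k1 k2].
have {}ind1 x2 : \sum_(t <- L | t.2.1 == k1) t.1 * phi2 t.2.2 x2 = 0.
  have := ind1 [seq (t.1 * phi2 t.2.2 x2, t.2.1) | t <- L].
  rewrite all_map => /(_ _ _ k1); rewrite big_map; apply=> [|x1].
    by apply: sub_all DL => t /andP[].
  rewrite big_map -[RHS](e (x1, x2)); apply: eq_bigr => t _ /=.
  by rewrite mulrA mulrAC.
have := ind2 [seq (t.1, t.2.2) | t <- L & t.2.1 == k1].
rewrite all_map => /(_ _ _ k2); rewrite big_map big_filter_cond => ind.
rewrite -[RHS]ind => [|/=|x2].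
- by apply: eq_bigl => t; rewrite -pair_eqE.
- by apply/allP => t; rewrite mem_filter => /andP[_ /(allP DL)/andP[]].
- by rewrite big_map big_filter; apply: ind1.
Qed.

Lemma independent_reindex (K K' : eqType) (X X' : Type) (D : pred K) (D' : pred K')
    (phi : K -> X -> F) (phi' : K' -> X' -> F) (h : K' -> K) :
  (forall k, D' k -> D (h k)) -> (forall k k', D' k -> D' k' -> h k = h k' -> k = k') ->
  (forall x, exists x', forall k, D' k -> phi' k x' = phi (h k) x) ->
  independent D phi -> independent D' phi'.
Proof.
move=> hD hinj hphi ind L DL e k.
have [kL|kL] := boolP (k \in [seq t.2 | t <- L]); last first.
  rewrite big_seq_cond big1 // => t /andP[tL /eqP tk].
  by case/mapP: kL; exists t.
have Dk : D' k by case/mapP: kL => t tL ->; apply: (allP DL).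
have := ind [seq (t.1, h t.2) | t <- L]; rewrite all_map => /(_ _ _ (h k)).
rewrite big_map => ind'; rewrite -[RHS]ind'.
- rewrite !(big_seq_cond (fun t => _ == _)); apply: eq_bigl => t /=.
  case tL: (t \in L) => //=; have Dt := allP DL t tL.
  by apply/eqP/eqP => [->//|]; apply: hinj.
- by apply: sub_all DL => t; apply: hD.
- move=> x; have [x' ex'] := hphi x; rewrite big_map -[RHS](e x').
  by rewrite !big_seq; apply: eq_bigr => t tL; rewrite ex' //; apply: (allP DL).
Qed.

(** A factor that depends on the index only can be taken out of the sum of the
    coefficients with that index. *)
Lemma sum_by_key (K : eqType) (P : pred K) (f : K -> F) (L : seq (F * K)) :
  (forall k, P k -> \sum_(t <- L | t.2 == k) t.1 = 0) ->
  \sum_(t <- L | P t.2) t.1 * f t.2 = 0.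
Proof.
move: {2}(size L) (leqnn (size L)) => n; elim: n L => [|n IH] [|t L] //=;
  try by rewrite big_nil.
rewrite ltnS => le H; rewrite (bigID (fun t' => t'.2 == t.2)) /=.
have rest : \sum_(t' <- t :: L | P t'.2 && (t'.2 != t.2)) t'.1 * f t'.2 = 0.
  have := IH [seq t' <- L | t'.2 != t.2]; rewrite size_filter.
  rewrite (leq_trans (count_size _ _)) // big_filter_cond => /(_ isT) E.
  rewrite -[RHS]E; first by rewrite big_cons eqxx andbF; apply: eq_bigl => t'; rewrite andbC.
  move=> k Pk; rewrite big_filter_cond; have [->|ktk] := eqVneq k t.2.
    by rewrite big1 // => t' /andP[/negPf ->].
  rewrite -[RHS](H k Pk) big_cons eq_sym (negPf ktk); apply: eq_bigl => t'.
  by have [->|] := eqVneq t'.2 k; rewrite ?andbF // ktk.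
rewrite rest addr0; case Pt: (P t.2); last first.
  by rewrite big1 // => t' /andP[Pt' /eqP e]; rewrite e Pt in Pt'.
rewrite -[RHS](mul0r (f t.2)) -[in RHS](H _ Pt) mulr_suml.
apply: eq_big => [t'|t' /andP[_ /eqP -> //]].
by have [->|_] := eqVneq t'.2 t.2; rewrite ?andbF ?Pt.
Qed.

Variables (q : nat) (fq : field_size F q).

Definition monomial (m : seq nat) (d : nat -> F) : F := \prod_(j <- m) d j.

Definition standard (m : seq nat) : bool := sorted leq m && reduced q m.

Lemma monomial_split m j d : monomial m d =
  d j ^+ count_mem j m * \prod_(l <- m | l != j) d l.
Proof.
rewrite /monomial (bigID (pred1 j)) /=; congr (_ * _).
rewrite (eq_bigr (fun=> d j)) => [|l /eqP -> //].
by rewrite big_const_seq iter_mulr_1.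
Qed.

(** As a polynomial in the [j]th variable, a vanishing combination of reduced
    monomials has vanishing coefficients. *)
Lemma monomial_class (L : seq (F * seq nat)) j a d :
  all (fun t => standard t.2) L ->
  (forall d, \sum_(t <- L) t.1 * monomial t.2 d = 0) ->
  \sum_(t <- L | count_mem j t.2 == a) t.1 * monomial t.2 d = 0.
Proof.
move=> stL e; pose r (t : F * seq nat) := t.1 * \prod_(l <- t.2 | l != j) d l.
pose p : {poly F} := \sum_(t <- L) r t *: 'X^(count_mem j t.2).
have coefp i : p`_i = \sum_(t <- L | count_mem j t.2 == i) r t.
  rewrite coef_sum [RHS]big_mkcond; apply: eq_bigr => t _.
  by rewrite coefZ coefXn eq_sym; case: eqP; rewrite ?mulr1 ?mulr0.
have p0 : p = 0.
  apply: (poly_vanish fq) => [i|x].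
    rewrite coefp; apply: contraR => ni; rewrite big_seq_cond big1 // => t /andP[tL /eqP ci].
    by case/negP: ni; rewrite -ci; have /andP[_ /reducedP] := allP stL t tL.
  rewrite horner_sum -[RHS](e (fun l => if l == j then x else d l)).
  apply: eq_bigr => t _; rewrite hornerZ hornerXn (monomial_split t.2 j) eqxx.
  rewrite /r -mulrA; congr (_ * _); rewrite mulrC; congr (_ * _).
  by apply: eq_bigr => l /negPf ->.
have := coefp a; rewrite p0 coef0 => /(congr1 ( *%R (d j ^+ a))).
rewrite mulr0 mulr_sumr => E; rewrite [RHS]E; apply: eq_bigr => t /eqP ct.
by rewrite (monomial_split t.2 j) ct mulrCA.
Qed.

(** Distinct reduced monomials differ in the degree of some variable, and
    grouping by that degree leaves shorter combinations. *)
Lemma independent_monomials : independent standard monomial.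
Proof.
move=> L; move: {2}(size L) (leqnn (size L)) => n.
elim: n L => [|n IH] L le stL e m; first by case: L le {stL e} => //; rewrite big_nil.
have [/mapP[t0 t0L mE]|mL] := boolP (m \in [seq t.2 | t <- L]); last first.
  rewrite big_seq_cond big1 // => t /andP[tL /eqP tm].
  by case/mapP: mL; exists t.
have [allm|/allPn[t tL tm]] := boolP (all (fun t => t.2 == m) L).
  rewrite -[RHS](e (fun=> 1)) big_seq_cond [RHS]big_seq.
  apply: eq_big => [t|t _]; last by rewrite /monomial big1_eq mulr1.
  by case tL: (t \in L) => //=; rewrite (allP allm).
have [j cj] : exists j, count_mem j t.2 != count_mem j m.
  apply: contrapT => no; case/negP: tm; apply/eqP.
  have /andP[st _] := allP stL _ tL; have /andP[st0 _] := allP stL _ t0L.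
  rewrite mE; apply: (sorted_eq leq_trans anti_leq) => //.
  apply/permP => P; have ct j : count_mem j t.2 = count_mem j t0.2.
    by apply/eqP; apply: contrapT => /negP nj; apply: no; exists j; rewrite mE.
  by apply/permP: P; apply/allP => j _ /=; apply/eqP.
have E : \sum_(t <- [seq t <- L | count_mem j t.2 == count_mem j m] | t.2 == m) t.1 = 0.
  apply: IH => [||d].
  - rewrite size_filter -ltnS (leq_trans _ le) //.
    rewrite -(count_predC (fun t => count_mem j t.2 == count_mem j m) L).
    by rewrite -[ltnLHS]addn0 ltn_add2l -has_count; apply/hasP; exists t.
  - by apply/allP => t'; rewrite mem_filter => /andP[_ /(allP stL)].
  - by rewrite big_filter; apply: monomial_class.
rewrite -[RHS]E big_filter_cond; apply: eq_bigl => t'.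
by have [->|] := eqVneq t'.2 m; rewrite ?andbF ?eqxx.
Qed.

Lemma independent_var_monomials :
  independent (fun k : nat * seq nat => standard k.2)
    (fun k (x : (nat -> F) * (nat -> F)) => x.1 k.1 * monomial k.2 x.2).
Proof.
apply: (@independent_prod nat (seq nat) (nat -> F) (nat -> F) predT standard
  (fun i x => x i) monomial _ independent_monomials).
move=> L _ e k; rewrite -[RHS](e (fun i => (i == k)%:R)) big_mkcond.
by apply: eq_bigr => t _; case: eqP; rewrite ?mulr1 ?mulr0.
Qed.

End Independence.

(** * Functions attached to atoms *)

Section AtomFunctions.
Variables (F : fieldType) (G : groupType) (q : nat) (fq : field_size F q).
Implicit Types (c : atom G) (x : (nat -> F) * (nat -> F)).

(** The value that an atom takes above the diagonal, as a function of the
    values of the variables there and of the differences of their values on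
    the diagonal. *)
Definition head_fun (h : atom_head G) x : F :=
  match h with
  | Hodd _ i => x.1 i
  | Heven i j => x.1 i * x.2 j - x.1 j * x.2 i
  | Hpow i => x.1 i * (x.2 i ^+ q.-1 - 1)
  end.

Definition atom_fun c x : F := head_fun c.1 x * monomial c.2 x.2.

(** The expansion of [atom_fun] as a combination of products of one value
    [x.1 i] and a monomial in [x.2]. *)
Definition atom_terms c : seq (F * (nat * seq nat)) :=
  let: (h, js) := c in
  match h with
  | Hodd _ i => [:: (1, (i, js))]
  | Heven i j => [:: (1, (i, j :: js)); (-1, (j, sort leq (i :: js)))]
  | Hpow i => [:: (1, (i, sort leq (nseq q.-1 i ++ js))); (-1, (i, js))]
  end.

Definition lead_term c : nat * seq nat := (head (0, (0, [::])) (atom_terms c)).2.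

Lemma monomial_perm m m' (d : nat -> F) : perm_eq m m' -> monomial m d = monomial m' d.
Proof. by move=> pe; apply: perm_big. Qed.

Lemma atom_fun_terms c x :
  atom_fun c x = \sum_(t <- atom_terms c) t.1 * (x.1 t.2.1 * monomial t.2.2 x.2).
Proof.
have ms m : monomial (sort leq m) x.2 = monomial m x.2.
  by apply: monomial_perm; rewrite perm_sort.
have mc i m : monomial (i :: m) x.2 = x.2 i * monomial m x.2 by rewrite /monomial big_cons.
case: c => [[g i|i j|i] js]; rewrite /atom_fun /= !big_cons big_nil addr0 /= ?ms ?mc ?mul1r //.
  by rewrite mulN1r mulrBl !mulrA.
rewrite /monomial big_cat big_nseq iter_mulr_1 mulN1r mulrA -mulrBl.
by rewrite mulrBr mulr1.
Qed.

Lemma count_small k js : reduced q js -> (0 < q)%N -> (count_mem k js < q)%N.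
Proof. by move=> /reducedP/(_ k); rewrite /small orbC; case: ltnP => //= _ /eqP ->. Qed.

Lemma atom_terms_standard c : normal q c -> all (fun t => standard q t.2.2) (atom_terms c).
Proof.
have std_sort m : reduced q m -> standard q (sort leq m).
  by move=> red; rewrite /standard sort_leq_sorted -(perm_reduced _ (perm_sort_leq m)).
have red_cons i m : reduced q (i :: m) -> reduced q m.
  move=> /reducedP red; apply/reducedP => k; have := red k; rewrite /small /=.
  by case: (q == 0%N) => //=; apply: leq_trans; rewrite ltnS leq_addl.
case: c => [[g i|i j|i] js] /=.
- by case/and3P=> _ st red; rewrite /standard st red.
- case/and3P=> ltji st red; rewrite andbT; apply/andP; split.
    by rewrite /standard /= st (red_cons _ _ red).
  apply: std_sort.
  have pe : perm_eq [:: i, j & js] [:: j, i & js] by rewrite (perm_catCA [:: i] [:: j]).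
  by apply: (red_cons j); rewrite -(perm_reduced _ pe).
- case/and4P=> q0 st ijs red; rewrite {2}/standard st red !andbT; apply: std_sort.
  apply/reducedP => k; rewrite /small count_cat count_nseq /=.
  have [<-|_] := eqVneq i k.
    by rewrite (count_memPn ijs) mul1n addn0 prednK ?leqnn ?orbT.
  by rewrite mul0n add0n count_small ?orbT.
Qed.

Definition is_pow c : bool := if c.1 is Hpow _ then true else false.

(** The first term of an atom determines it. For a normal atom [Heven i j], the
    first term has an entry [j] below its index [i], whereas in the second term
    the index is at most all entries. For an atom [Hpow i] the first term has
    degree [q - 1] in the variable of its index, and in all terms of
    other kinds this degree is smaller. Only the second term of an atom [Hpow]
    can be the first term of another atom. *)
Lemma lead_coef_atom c c' : normal q c -> normal q c' ->
  head_deg c.1 = head_deg c'.1 -> is_pow c || ~~ is_pow c' ->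
  \sum_(t <- atom_terms c' | t.2 == lead_term c) t.1 = (c' == c)%:R.
Proof.
have lt_pred (k : nat) : (0 < q)%N -> (k.+1 < q)%N -> k = q.-1 -> False.
  by move=> q0; rewrite -ltn_predRL => lt e; rewrite e ltnn in lt.
have pow_count i js k : i \notin js -> i = k ->
    count_mem k (sort leq (nseq q.-1 i ++ js)) = q.-1.
  move=> ijs <-; rewrite count_sort count_cat count_nseq /= eqxx.
  by rewrite mul1n (count_memPn ijs) addn0.
case: c => [[g i|i j|i] js]; case: c' => [[g' i'|i' j'|i'] js'];
  rewrite ?big_cons ?big_nil /lead_term //= => nc nc' deg //.
- move=> _; rewrite addr0 deg; case: eqP => [[-> ->]|ne]; first by rewrite eqxx.
  by case: eqP => // -[ei ej]; case: ne; rewrite ei ej.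
- by case/and3P: nc => /eqP; rewrite deg.
- by case/and3P: nc' => /eqP; rewrite -deg.
- move=> _; case/and3P: nc => ltji st red; case/and3P: nc' => ltji' st' red'.
  rewrite [X in if X then -1 + 0 else 0]
    (_ : ((j', sort leq (i' :: js')) == (i, j :: js)) = false) ?addr0; last first.
    apply/eqP => -[ej es]; have : j \in sort leq (i' :: js') by rewrite es mem_head.
    rewrite mem_sort inE => /predU1P[ji'|jjs'].
      by move: ltji; rewrite ji' -ej ltnNge ltnW.
    have := allP (order_path_min leq_trans st') _ jjs'.
    by rewrite ej leqNgt ltji.
  case: eqP => [[-> -> ->]|ne]; first by rewrite eqxx.
  by case: eqP => // -[ei ej ejs]; case: ne; rewrite ei ej ejs.
- by case/andP: nc' => /eqP; rewrite -deg.
- move=> _; case/and4P: nc => q0 st ijs red; case/and3P: nc' => ltji' st' red'.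
  have cnt k : (count_mem k [:: i', j' & js'] < q)%N by apply: count_small.
  rewrite (_ : (_, _ :: _) == _ = false); last first.
    apply/eqP => -[ei es]; have := pow_count _ _ _ ijs erefl; rewrite -es /=.
    by apply: lt_pred => //; have := cnt i; rewrite /= ei eqxx.
  rewrite (_ : (_, sort _ (i' :: _)) == _ = false); last first.
    apply/eqP => -[ei es]; have := pow_count _ _ _ ijs erefl; rewrite -es.
    rewrite count_sort /=.
    by apply: lt_pred => //; have := cnt i; rewrite /= ei eqxx addnCA.
  by case: eqP.
- move=> _; case/and4P: nc => q0 st ijs red; case/and4P: nc' => _ st' ijs' red'.
  rewrite [(i', js') == _](_ : _ = false); last first.
    apply/eqP => -[ei es]; have := pow_count _ _ _ ijs erefl; rewrite -es -ei.
    by rewrite (count_memPn ijs') => e; move: (field_size_gt1 fq q0);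
      rewrite -(prednK q0) -e.
  rewrite addr0; case: eqP => [[ei es]|ne]; last first.
    by case: eqP => // -[ei ej]; case: ne; rewrite ei ej.
  suff ejs : js' = js by rewrite ei ejs eqxx.
  apply: (sorted_eq leq_trans anti_leq) => //.
  have : perm_eq (nseq q.-1 i ++ js') (nseq q.-1 i ++ js).
    rewrite -[in X in perm_eq X]ei (perm_trans (perm_sort_leq _)) // es perm_sym.
    exact: perm_sort_leq.
  by rewrite perm_cat2l.
Qed.

Lemma independent_atoms g :
  independent (fun c => normal q c && (head_deg c.1 == g)) atom_fun.
Proof.
move=> L DL e; pose terms := [seq (t.1 * s.1, s.2) | t <- L, s <- atom_terms t.2].
have normL t : t \in L -> normal q t.2 /\ head_deg t.2.1 = g.
  by move=> /(allP DL)/andP[nt /eqP].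
have stt : all (fun t => standard q t.2.2) terms.
  apply/allP => _ /allpairsPdep[t [s [tL sc ->]]] /=.
  exact: (allP (atom_terms_standard (normL t tL).1)).
have coefs := independent_var_monomials fq stt.
have {}coefs k : \sum_(t <- L) t.1 * (\sum_(s <- atom_terms t.2 | s.2 == k) s.1) = 0.
  rewrite -[RHS](coefs _ k).
    rewrite [RHS]big_mkcond /terms [RHS]big_allpairs_dep /=.
    by apply: eq_bigr => t _; rewrite -big_mkcond mulr_sumr.
  move=> x; rewrite /terms big_allpairs_dep -[RHS](e x); apply: eq_bigr => t _.
  by rewrite atom_fun_terms mulr_sumr; apply: eq_bigr => s _; rewrite [RHS]mulrA.
have key c : c \in [seq t.2 | t <- L] -> (is_pow c \/
    forall c', is_pow c' -> \sum_(t <- L | t.2 == c') t.1 = 0) ->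
    \sum_(t <- L | t.2 == c) t.1 = 0.
  case/mapP=> t0 t0L -> pow; have [n0 d0] := normL t0 t0L.
  have lead t : t \in L -> is_pow t0.2 || ~~ is_pow t.2 ->
      \sum_(s <- atom_terms t.2 | s.2 == lead_term t0.2) s.1 = (t.2 == t0.2)%:R.
    by move=> tL; have [nt dt] := normL t tL; apply: lead_coef_atom; rewrite ?d0.
  rewrite -[RHS](coefs (lead_term t0.2)).
  rewrite [RHS](bigID (fun t => is_pow t0.2 || ~~ is_pow t.2)) /=.
  rewrite [X in _ = _ + X](_ : _ = 0) ?addr0.
    rewrite big_mkcond [RHS]big_mkcond !big_seq; apply: eq_bigr => t tL.
    case: ifP => [/eqP tt0|ne]; case: ifP => // np.
    - by rewrite lead // tt0 eqxx mulr1.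
    - by rewrite tt0 orbN in np.
    - by rewrite lead // ne mulr0.
  case: pow => [-> /=|pow]; first by rewrite big_pred0.
  apply: (sum_by_key (P := fun c => ~~ (is_pow t0.2 || ~~ is_pow c))
    (fun c => \sum_(s <- atom_terms c | s.2 == lead_term t0.2) s.1)) => c'.
  by rewrite negb_or negbK => /andP[_]; apply: pow.
(* The atoms [Hpow] are eliminated before the others. *)
have van c : is_pow c \/ (forall c', is_pow c' -> \sum_(t <- L | t.2 == c') t.1 = 0) ->
    \sum_(t <- L | t.2 == c) t.1 = 0.
  move=> pow; have [cL|cL] := boolP (c \in [seq t.2 | t <- L]); first exact: key.
  rewrite big_seq_cond big1 // => t /andP[tL /eqP tc].
  by case/mapP: cL; exists t.
by move=> c; apply: (van c); right=> c' pc'; apply: (van c'); left.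
Qed.

(** The value of a product of atoms at the end of the first row, if each atom
    has to advance by exactly one position. *)
Fixpoint atoms_fun (l : seq (atom G)) (v : nat -> (nat -> F) * (nat -> F)) : F :=
  if l is c :: l' then atom_fun c (v 0) * atoms_fun l' (fun k => v k.+1) else 1.

(** The factors of a product are evaluated at independent points, so the first
    one splits off. *)
Lemma independent_atoms_seq (eta : seq G) :
  independent (fun l => all (normal q) l && (map (fun c => head_deg c.1) l == eta)) atoms_fun.
Proof.
elim: eta => [|g eta IH].
  move=> L DL e l; have nil t : t \in L -> t.2 = [::].
    by move=> /(allP DL)/andP[_]; case: (t.2).
  have [->|nl] := eqVneq l [::].
    rewrite -[RHS](e (fun=> (fun=> 0, fun=> 0))) big_mkcond !big_seq.
    by apply: eq_bigr => t /nil ->; rewrite eqxx /= mulr1.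
  by rewrite big_seq_cond big1 // => t /andP[/nil -> /eqP ln]; rewrite -ln eqxx in nl.
pose c0 : atom G := (Heven G 0 0, [::]).
apply: (independent_reindex (h := fun l => (head c0 l, behead l)) _ _ _
  (independent_prod (@independent_atoms g) IH)).
- by case=> // c l /= /andP[/andP[-> ->] /eqP[-> ->]]; rewrite !eqxx.
- move=> [|c l] [|c' l'] /andP[_ /eqP e1] /andP[_ /eqP e2] //=.
  by case=> -> ->.
- move=> [x v]; exists (fun k => if k is k'.+1 then v k' else x).
  by case=> //= /andP[].
Qed.

End AtomFunctions.

(** * Entries next to the diagonal *)

Section Naturality.
Variables (F : fieldType) (G : groupType) (R : algType F) (b : G * nat -> R) (q : nat).
Local Notation A := (freeAlg F G).

Lemma fmorph_lbracket (u : A) js : fmorph b (lbracket u (map (yvar F G) js)) =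
  lbracket (fmorph b u) (map (fun i => b (1%g, i)) js).
Proof.
elim: js u => //= j js IH u; rewrite IH; congr lbracket.
by rewrite (fmorph_comm b u (yvar F G j)) fmorph_yvar.
Qed.

Lemma fmorph_atom c : fmorph b (atom_val (@genx F G) q c) = atom_val b q c.
Proof.
rewrite [LHS]fmorph_lbracket; congr lbracket.
case: c.1 => [g i|i j|i] /=; first exact: fmorph_xvar.
  by rewrite (fmorph_comm b (yvar F G i) (yvar F G j)) !fmorph_yvar.
by rewrite (fmorph_pow b q (yvar F G i)) fmorph_yvar.
Qed.

Lemma fmorph_straight m l :
  fmorph b (evens_val (@genx F G) m * atoms_val (@genx F G) q l) =
  evens_val b m * atoms_val b q l.
Proof.
rewrite fmorphM; congr (_ * _).
  rewrite [LHS](rmorph_prod (fmorph b)); apply: eq_bigr => i _.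
  exact: fmorph_xvar.
rewrite [LHS](rmorph_prod (fmorph b)); apply: eq_bigr => c _.
exact: fmorph_atom.
Qed.

End Naturality.

Section Superdiagonal.
Variables (F : fieldType) (n : nat).
Implicit Types (B C W Y : 'M[F]_n.+1) (i j k : 'I_n.+1).

Definition level d B : Prop := forall i j, B i j != 0 -> (i + d <= j)%N.

Lemma level_lt d B i j : level d B -> (j < i + d)%N -> B i j = 0.
Proof. by move=> lB lt; apply: contraTeq lt => /lB; rewrite -leqNgt. Qed.

Lemma upper_level0 B : upper B <-> level 0 B.
Proof. by split=> uB i j /uB; rewrite addn0. Qed.

Lemma level1_upper B : level 1 B -> upper B.
Proof. by move=> lB i j /lB; apply: leq_trans; rewrite leq_addr. Qed.

Lemma level1 B : upper B -> (forall i, B i i = 0) -> level 1 B.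
Proof.
move=> uB d0 i j nz; rewrite addn1 ltn_neqAle uB // andbT.
by apply: contraNneq nz => e; rewrite (val_inj e) d0.
Qed.

Lemma levelM d e B C : level d B -> level e C -> level (d + e) (B * C).
Proof.
move=> lB lC i j nz; rewrite leqNgt; apply: contra nz => lt; apply/eqP.
rewrite mxE big1 // => k _; have [ltk|lek] := ltnP k (i + d).
  by rewrite (level_lt lB) // mul0r.
by rewrite (level_lt lC) ?mulr0 // (leq_trans lt) // addnA leq_add2r.
Qed.

(** A product of matrices supported from the [d]th and [e]th diagonals on has
    a single contribution to an entry on the [d + e]th diagonal. *)
Lemma level_entryM d e B C i k j : level d B -> level e C ->
  k = (i + d)%N :> nat -> j = (k + e)%N :> nat -> (B * C) i j = B i k * C k j.
Proof.
move=> lB lC ek ej; rewrite mxE (bigD1 k) //= big1 ?addr0 // => k' ne.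
have [lt|le] := ltnP k' (i + d); first by rewrite (level_lt lB) // mul0r.
rewrite (level_lt lC) ?mulr0 // ej ltn_add2r ltn_neqAle ek le andbT.
by rewrite -ek eq_sym.
Qed.

Variables (i j : 'I_n.+1).
Hypothesis ij : j = i.+1 :> nat.

Lemma super_entryM B C : upper B -> upper C ->
  (B * C) i j = B i i * C i j + B i j * C j j.
Proof.
move=> uB uC; have neq : j != i by rewrite -val_eqE /= ij gtn_eqF.
rewrite mxE (bigD1 i) //= (bigD1 j) //= big1 ?addr0 // => k /andP[ki kj].
have [lt|le] := ltnP k i; first by rewrite (upper_lt uB) // mul0r.
have ltik : (i < k)%N by rewrite ltn_neqAle val_eqE eq_sym ki.
by rewrite (upper_lt uC) ?mulr0 // ltn_neqAle val_eqE eq_sym kj ij ltik.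
Qed.

Lemma super_bracket B C : upper B -> upper C ->
  (bracket B C) i j = B i j * (C j j - C i i) - C i j * (B j j - B i i).
Proof.
move=> uB uC; rewrite /bracket sub_mxE !super_entryM //; ring.
Qed.

Lemma super_expM B (k : nat) : upper B ->
  (B ^+ k) i j * (B j j - B i i) = B i j * (B j j ^+ k - B i i ^+ k).
Proof.
move=> uB; elim: k => [|k IH].
  by rewrite mxE -val_eqE /= ij ltn_eqF // !expr0 subrr mulr0 mul0r.
rewrite exprS super_entryM //; last exact: upperX.
by rewrite mulrDl -mulrA IH diagX // !exprS; ring.
Qed.

Lemma super_exp_eq B (k : nat) : upper B -> B i i = B j j ->
  (B ^+ k) i j = B i j * B i i ^+ k.-1 *+ k.
Proof.
move=> uB e; elim: k => [|k IH].
  by rewrite mxE -val_eqE /= ij ltn_eqF // mulr0n.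
rewrite exprS super_entryM //; last exact: upperX.
rewrite IH diagX // -e /= [in RHS]mulrS addrC; congr (_ + _).
by case: k {IH} => [|k] /=; rewrite ?mulr0n ?mulr0 // mulrnAr mulrCA -exprS.
Qed.

(** Above the diagonal a power takes the difference quotient of [t ^+ q] on the
    diagonal, and [t ^+ q = t] there; if the two diagonal values coincide, the
    quotient is the derivative, which is zero. *)
Lemma super_pow q B : card_field F q -> upper B ->
  (B ^+ q - B) i j = B i j * ((B j j - B i i) ^+ q.-1 - 1).
Proof.
move=> cq uB; rewrite sub_mxE; have q1 := card_field_gt1 cq.
have [e|ne] := eqVneq (B j j) (B i i).
  rewrite super_exp_eq // e subrr expr0n -[(q.-1 == 0)%N]negbK -lt0n.
  rewrite -subn1 subn_gt0 q1 /= sub0r mulrN1 -[X in _ = X]add0r; congr (_ - _).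
  have := card_field_bin cq (i := 1); rewrite bin1 q1 => /(_ isT) q0.
  by rewrite -mulr_natr q0 mulr0.
have d0 : B j j - B i i != 0 by rewrite subr_eq0.
have -> : (B ^+ q) i j = B i j.
  by apply: (mulIf d0); rewrite super_expM // !(card_field_exp cq).
suff -> : (B j j - B i i) ^+ q.-1 = 1 by rewrite !subrr mulr0.
apply: (mulIf d0); rewrite mul1r -exprSr prednK ?(card_field_exp cq) //.
exact: ltnW.
Qed.

End Superdiagonal.

(** * Evaluation along a walk *)

Section AtomEntries.
Variables (F : fieldType) (G : groupType) (q : nat) (fq : field_size F q).
Variables (n : nat) (b : G * nat -> 'M[F]_n.+1).
Hypothesis ub : forall x, upper (b x).
Hypothesis odd_level : forall g i, g != 1%g -> level 1 (b (g, i)).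
Implicit Types (i j k : 'I_n.+1) (c : atom G) (l : seq (atom G)).

Lemma level1_bracket (B C : 'M[F]_n.+1) : upper B -> upper C -> level 1 (bracket B C).
Proof.
move=> uB uC; apply: level1 => [|i]; last exact: diag_bracket.
by apply: upperB; apply: upperM.
Qed.

Lemma level1_head h : valid q h -> level 1 (head_val b q h).
Proof.
case: h => [g i|i j|i] /= v; [exact: odd_level | exact: level1_bracket |].
apply: level1 => [|k]; first by apply: upperB; [apply: upperX|].
rewrite sub_mxE diagX // (@card_field_exp _ q) ?subrr //.
by move: fq v; case: (q).
Qed.

Lemma level1_atom c : valid q c.1 -> level 1 (atom_val b q c).
Proof.
move=> v; rewrite /atom_val; move: (level1_head v); move: (head_val _ _ _) => B.
elim: c.2 B => //= j js IH B lB; apply/IH/level1_bracket => //.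
exact: level1_upper.
Qed.

Lemma level_atoms l : all (fun c => valid q c.1) l -> level (size l) (atoms_val b q l).
Proof.
elim: l => [_|c l IH /= /andP[vc vl]].
  by rewrite /atoms_val big_nil; apply/upper_level0/upper1.
by rewrite /atoms_val big_cons -add1n; apply: levelM (level1_atom vc) (IH vl).
Qed.

Lemma super_atom c i j : j = i.+1 :> nat -> valid q c.1 ->
  atom_val b q c i j = atom_fun q c
    (fun v => b (head_deg c.1, v) i j, fun v => b (1%g, v) j j - b (1%g, v) i i).
Proof.
move=> ij vc; rewrite /atom_val /atom_fun.
have -> : head_fun q c.1
    (fun v => b (head_deg c.1, v) i j, fun v => b (1%g, v) j j - b (1%g, v) i i) =
    head_val b q c.1 i j.
  case: c.1 vc => [g v|v w|v] //= vc; first by rewrite super_bracket.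
  by rewrite (super_pow ij) //; move: fq vc; case: (q).
move: (level1_head vc); move: (head_val _ _ _) => B.
elim: c.2 B => [|v js IH] B lB /=; first by rewrite /monomial big_nil mulr1.
have uB := level1_upper lB; rewrite IH; last exact: level1_bracket.
have Bd k : B k k = 0 by rewrite (level_lt lB) ?addn1.
rewrite super_bracket // !Bd subrr mulr0 subr0.
by rewrite /monomial big_cons mulrA.
Qed.

Lemma atoms_entry l i j v : all (fun c => valid q c.1) l -> (i + size l)%N = j ->
  (forall (k : nat) c i' j', (k < size l)%N -> c = nth c l k ->
     i' = (i + k)%N :> nat -> j' = i'.+1 :> nat ->
     atom_val b q c i' j' = atom_fun q c (v k)) ->
  atoms_val b q l i j = atoms_fun q l v.
Proof.
elim: l i v => [|c l IH] i v /= => [_|/andP[vc vl]] eij hv.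
  by rewrite /atoms_val big_nil mxE (_ : i = j) ?eqxx //; apply/val_inj; rewrite /= -eij addn0.
have lti : (i.+1 < n.+1)%N.
  by apply: leq_ltn_trans (ltn_ord j); rewrite -eij addnS ltnS leq_addr.
pose i1 : 'I_n.+1 := Ordinal lti.
rewrite /atoms_val big_cons (level_entryM (k := i1) (level1_atom vc) (level_atoms vl)).
- rewrite (hv 0%N) ?addn0 //; congr (_ * _); apply: (IH i1) => //.
    by rewrite /= addSnnS.
  move=> k c' i' j' lt ec ei ej; apply: (hv k.+1) => //.
  by rewrite ei /= addSnnS.
- by rewrite /= addn1.
- by rewrite -eij /= addSnnS.
Qed.

Lemma atoms_entry_neq0 l i j : all (fun c => valid q c.1) l -> (i + size l)%N = j ->
  atoms_val b q l i j != 0 ->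
  forall (k : nat), (k < size l)%N -> exists i' j', [/\ i' = (i + k)%N :> nat,
    j' = i'.+1 :> nat & atom_val b q (nth (Heven G 0 0, [::]) l k) i' j' != 0].
Proof.
elim: l i => [|c l IH] i //= /andP[vc vl] eij nz.
have lti : (i.+1 < n.+1)%N.
  by apply: leq_ltn_trans (ltn_ord j); rewrite -eij addnS ltnS leq_addr.
pose i1 : 'I_n.+1 := Ordinal lti.
move: nz; rewrite /atoms_val big_cons.
rewrite (level_entryM (k := i1) (level1_atom vc) (level_atoms vl)) /= ?addn1 -?eij ?addSnnS //.
rewrite mulf_eq0 negb_or => /andP[nzc nzl] [_|k]; first by exists i, i1; rewrite addn0.
rewrite ltnS => lt; have [|i' [j' [ei ej nz]]] := IH i1 vl _ nzl k lt.
  by rewrite /= addSnnS.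
by exists i', j'; split=> //; rewrite ei /= addSnnS.
Qed.

End AtomEntries.

Section ChainEvaluation.
Variables (F : fieldType) (G : groupType) (eps : nat -> G).
Variables (q : nat) (fq : field_size F q).
Local Notation dg := (deg_between eps).
Variables (eta : seq G) (i0 : nat) (t : seq nat).
Hypothesis walk_eta : walk eps eta i0 t.
Variables (d0 : nat -> F) (v : nat -> (nat -> F) * (nat -> F)).
Local Notation n := (size t).
Implicit Types (i j : 'I_n.+1) (l : seq (atom G)).

Definition chain_index i : nat := nth 0%N (i0 :: t) i.

Lemma chain_increasing : increasing chain_index.
Proof.
have srt : sorted ltn (i0 :: t) by case: walk_eta.
have inc i j : (i < j)%N -> (chain_index i < chain_index j)%N.
  by move=> lt; apply: (sorted_ltn_nth ltn_trans) => //; rewrite inE /= ltn_ord.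
move=> i j; apply/idP/idP => [|/inc //]; apply: contraLR; rewrite -leqNgt leq_eqVlt.
by move=> /predU1P[/val_inj ->|/inc lt]; rewrite ?ltnn // -leqNgt ltnW.
Qed.

Lemma size_eta : size eta = n.
Proof. by case: walk_eta => _ <-; rewrite size_pairmap. Qed.

Lemma chain_deg i j : j = i.+1 :> nat -> dg (chain_index i) (chain_index j) = nth 1%g eta i.
Proof.
case: walk_eta => _ <- ij; rewrite /chain_index ij.
by rewrite (nth_pairmap 0%N) //; rewrite -ltnS -ij ltn_ord.
Qed.

(** On the diagonal the values of the even variables start from [d0] and have
    the prescribed differences; just above it stand the prescribed values,
    kept in the degree that the chain assigns to the position. *)
Definition chain_mx (x : G * nat) : 'M[F]_n.+1 :=
  \matrix_(i, j)
    if i == j then (x.1 == 1%g)%:R * (d0 x.2 + \sum_(k < i) (v k).2 x.2)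
    else if j == i.+1 :> nat then (x.1 == nth 1%g eta i)%:R * (v i).1 x.2
    else 0.

Lemma chain_mx_homog x : mx_homog eps chain_index x.1 (chain_mx x).
Proof.
move=> i j; rewrite mxE; have [<-|_] := eqVneq i j.
  have [->|] := eqVneq x.1 1%g; last by rewrite mul0r eqxx.
  by rewrite deg_between_id.
have [ij|_] := eqVneq (j : nat) i.+1; last by rewrite eqxx.
have [->|_] := eqVneq x.1 (nth 1%g eta i); last by rewrite mul0r eqxx.
by rewrite chain_deg // ij leqnSn.
Qed.

Lemma chain_upper x : upper (chain_mx x).
Proof. by move=> i j /chain_mx_homog[]. Qed.

Lemma chain_odd g k : g != 1%g -> level 1 (chain_mx (g, k)).
Proof.
move=> g1; apply: level1 => [|i]; first exact: chain_upper.
by rewrite mxE eqxx /= (negPf g1) mul0r.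
Qed.

Lemma chain_evens m : evens_val chain_mx m ord0 ord0 = monomial m d0.
Proof.
rewrite /evens_val /monomial; elim: m => [|k m IH]; first by rewrite !big_nil mxE eqxx.
rewrite !big_cons diagM ?IH.
- by rewrite mxE eqxx /= eqxx mul1r big_ord0 addr0.
- exact: chain_upper.
elim: m {IH} => [|k' m IH]; first by rewrite big_nil; apply: upper1.
by rewrite big_cons; apply: upperM IH; apply: chain_upper.
Qed.

(** Too many atoms overshoot the last column. With as many atoms as steps each
    atom contributes its entry next to the diagonal, which is zero unless its
    degree is the degree of that step. *)
Lemma chain_atoms l : all (fun c => valid q c.1) l -> (n <= size l)%N ->
  atoms_val chain_mx q l ord0 ord_max =
  if map (fun c => head_deg c.1) l == eta then atoms_fun q l v else 0.
Proof.
move=> vl; rewrite leq_eqVlt => /predU1P[sz|lt]; last first.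
  rewrite (level_lt (level_atoms fq chain_upper chain_odd vl)) //; case: eqP => // el.
  by move: lt; rewrite -size_eta -el size_map ltnn.
case: eqP => [el|ne].
  apply: (atoms_entry fq chain_upper chain_odd) => // k c i j lt ec ei ij.
  have vc : valid q c.1 by rewrite ec; apply: (allP vl); apply: mem_nth.
  rewrite (super_atom fq chain_upper chain_odd) //; congr atom_fun.
  have ik : i = k :> nat by rewrite ei add0n.
  have dc : head_deg c.1 = nth 1%g eta i.
    by rewrite -el ik (nth_map c) // -ec.
  have neq : (i == j) = false by rewrite -val_eqE /= ij ltn_eqF.
  rewrite [v k]surjective_pairing; congr (_, _); apply/funext => w; rewrite !mxE /=.
    by rewrite neq ij eqxx dc eqxx mul1r ik.
  by rewrite !eqxx !mul1r ij big_ord_recr /= ik opprD addrACA subrr add0r addrAC subrr add0r.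
apply/eqP; apply: contra_notT ne => nz; apply: (@eq_from_nth _ 1%g).
  by rewrite size_map -sz size_eta.
rewrite size_map => k lt.
have e : ((ord0 : 'I_n.+1) + size l)%N = (ord_max : 'I_n.+1) by rewrite /= add0n -sz.
have [i [j [ei ij nzk]]] := atoms_entry_neq0 fq chain_upper chain_odd vl e nz lt.
rewrite (nth_map (Heven G 0 0, [::])) //.
rewrite -fmorph_atom in nzk.
have [_ <-] := mx_homog_fmorph chain_increasing chain_mx_homog (@homog_atom F G q _) nzk.
by rewrite chain_deg // ei add0n.
Qed.

Lemma chain_evaluation m l : all (fun c => valid q c.1) l -> (n <= size l)%N ->
  fmorph chain_mx (evens_val (@genx F G) m * atoms_val (@genx F G) q l) ord0 ord_max =
  if map (fun c => head_deg c.1) l == eta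
  then monomial m d0 * atoms_fun q l v else 0.
Proof.
move=> vl le; rewrite fmorph_straight.
have ue : level 0 (evens_val chain_mx m).
  apply/upper_level0; elim: m => [|k m IH]; first by rewrite /evens_val big_nil; apply: upper1.
  by rewrite /evens_val big_cons; apply: upperM IH; apply: chain_upper.
have la : level n (atoms_val chain_mx q l).
  by move=> i j /(level_atoms fq chain_upper chain_odd vl); apply: leq_trans; rewrite leq_add2l.
rewrite (level_entryM (k := ord0) ue la) // chain_evens chain_atoms //.
by case: eqP => // _; rewrite mulr0.
Qed.

End ChainEvaluation.

(** * Independence of the basis products *)

Section BasisProducts.
Variables (F : fieldType) (G : groupType) (eps : nat -> G).
Variables (q : nat) (fq : field_size F q).
Local Notation A := (freeAlg F G).
Local Notation y := (yvar F G).
Local Notation X := (@genx F G).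
Local Notation degs := (map (fun c : atom G => head_deg c.1)).
Implicit Types (c : atom G) (l : seq (atom G)) (m : seq nat).

Lemma normal_valid l : all (normal q) l -> all (fun c => valid q c.1) l.
Proof. by apply: sub_all => -[h js] /andP[]. Qed.

(** The zero polynomial is homogeneous of every degree, so the degree of a
    factor is determined only because the factor is nonzero. A grading adapted to
    the degree of the atom makes a nonzero value visible. *)
Lemma atom_neq0 c : normal q c -> atom_val X q c != 0.
Proof.
move=> nc; apply/eqP => c0; pose g := head_deg c.1.
have w : walk (fun=> g) [:: g] 0 [:: 1%N].
  by split=> //=; rewrite /deg_between big_nat1.
have ev0 (x : (nat -> F) * (nat -> F)) : atom_fun q c x = 0.
  have := chain_evaluation fq w (fun=> 0) (fun=> x) [::] (l := [:: c]).
  rewrite /atoms_val big_seq1 c0 mulr0 (raddf0 (fmorph _)) mxE /= eqxx.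
  rewrite /monomial big_nil mul1r mulr1 => <- //.
  by rewrite andbT; case: (c) nc => h js /andP[].
have := independent_atoms fq (g := g) (L := [:: (1, c)]).
rewrite /= nc eqxx => /(_ isT _ c); rewrite big_cons big_nil eqxx addr0 => e.
have /eqP : (1 : F) = 0 by apply: e => x; rewrite big_seq1 mul1r ev0.
by rewrite oner_eq0.
Qed.

Lemma card_small k q' : (0 < q)%N -> card_field F q' ->
  small q k = (k <= q' - 1)%N.
Proof.
move=> q0 /(field_size_card fq) <-.
by rewrite /small gtn_eqF // subn1 -[RHS]ltnS prednK.
Qed.

Lemma basis_factorP (f : A) :
  basis_factor f <-> exists2 c, normal q c & f = atom_val X q c.
Proof.
split.
  case=> [[inf ss]|[q' cq' ln]].
    have q0 : q = 0%N by case: (q) fq => // q' cq'; case: inf; exists q'.+1.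
    have red js : reduced q js by apply/allP => k _; rewrite /small q0.
    case: ss => [[g [i [js [g1 st ->]]]]|[i [j [js [lt st ->]]]]].
      by exists (Hodd g i, js); rewrite //= red st; case: eqP g1.
    by exists (Heven G i j, js); rewrite //= red lt; move: st => /= ->.
  have qq' := field_size_card fq cq'; subst q'.
  have q0 : (0 < q)%N by apply: ltnW; apply: card_field_gt1 cq'.
  have red js : (forall k, (count_mem k js <= q - 1)%N) -> reduced q js.
    by move=> h; apply/reducedP => k; rewrite (card_small _ q0 cq').
  case: ln => [[g [i [js [g1 st /red rd ->]]]]|[i [j [js [lt st /red rd ->]]]]|
    [i [js [st ijs /red rd ->]]]].
  - by exists (Hodd g i, js); rewrite //= rd st; case: eqP g1.
  - by exists (Heven G i j, js); rewrite //= lt /=; apply/andP.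
  - by exists (Hpow G i, js); rewrite //= q0 st ijs rd.
case=> -[h js] nc ->; case q0: (q == 0)%N.
  left; split; first by move: fq; rewrite (eqP q0).
  case: h nc => [g i|i j|i] /=.
  - by case/and3P=> /eqP g1 st _; left; exists g, i, js.
  - by case/and3P=> lt st _; right; exists i, j, js.
  - by rewrite (eqP q0).
have {}q0 : (0 < q)%N by rewrite lt0n q0.
have cq : card_field F q by move: fq q0; case: (q).
have red s : reduced q s -> forall k, (count_mem k s <= q - 1)%N.
  by move=> /reducedP r k; rewrite -(card_small _ q0 cq).
right; exists q => //; case: h nc => [g i|i j|i] /=.
- by case/and3P=> /eqP g1 st /red rd; apply: Or31; exists g, i, js.
- by case/and3P=> lt st /red rd; apply: Or32; exists i, j, js.
- by case/and4P=> _ st ijs /red rd; apply: Or33; exists i, js.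
Qed.

Definition spread (a : nat -> nat) (s : nat) : seq nat :=
  flatten [seq nseq (a i) i | i <- iota 0 s].

Lemma spreadS a s : spread a s.+1 = spread a s ++ nseq (a s) s.
Proof. by rewrite /spread -addn1 iotaD map_cat flatten_cat /= cats0. Qed.

Lemma spread_sorted a s : sorted leq (spread a s).
Proof.
rewrite (sorted_pairwise leq_trans); elim: s => // s IH.
rewrite spreadS pairwise_cat IH /=; apply/andP; split; last first.
  rewrite -(sorted_pairwise leq_trans); elim: (a s) => // -[|k] //= {}IH.
  by rewrite leqnn.
apply/allrelP => i j /flattenP[_ /mapP[k kin ->]] /nseqP[-> _] /nseqP[-> _].
by move: kin; rewrite mem_iota => /ltnW.
Qed.

Lemma spread_count a s k : count_mem k (spread a s) = (if (k < s)%N then a k else 0%N).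
Proof.
elim: s => // s IH; rewrite spreadS count_cat IH count_nseq /= ltnS [(k <= s)%N]leq_eqVlt.
rewrite [s == k]eq_sym; have [->|ks] := eqVneq k s; last by rewrite mul0n addn0.
by rewrite ltnn mul1n.
Qed.

Lemma spread_evens a s : evens_val X (spread a s) = \prod_(i < s) y i ^+ a i.
Proof.
elim: s => [|s IH]; first by rewrite big_ord0 /evens_val big_nil.
by rewrite spreadS evens_cat evens_nseq IH big_ord_recr.
Qed.

Lemma spread_id m : sorted leq m ->
  m = spread (fun i => count_mem i m) (\max_(i <- m) i).+1.
Proof.
move=> st; apply: (sorted_eq leq_trans anti_leq) => //; first exact: spread_sorted.
apply/allP => k _ /=; rewrite spread_count ltnS; case: leqP => // lt.
apply/eqP/count_memPn; apply: contraL lt => km; rewrite -leqNgt.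
exact: leq_bigmax_seq.
Qed.

Lemma basis_productP (f : A) : basis_product eps f <-> exists m l,
  [/\ standard q m, all (normal q) l, good eps F (degs l)
    & f = evens_val X m * atoms_val X q l].
Proof.
split; last first.
  case=> m [l [/andP[st red] nl gd ->]].
  exists (\max_(i <- m) i).+1, (fun i => count_mem (val i) m), (size l).
  exists (fun i => atom_val X q (tnth (in_tuple l) i)).
  exists (map_tuple (fun c => head_deg c.1) (in_tuple l)).
  split.
  - move=> i q' cq'; have := reducedP _ _ red (val i); rewrite /small.
    rewrite (field_size_card fq cq') => /orP[/eqP z|//].
    by have := card_field_gt1 cq'; rewrite z.
  - exact: gd.
  - by move=> i; rewrite tnth_map; apply: homog_atom.
  - move=> i; apply/basis_factorP; exists (tnth (in_tuple l) i); last by [].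
    by apply: (allP nl); apply: (mem_tnth i (in_tuple l)).
  - have e1 := etrans (congr1 (evens_val X) (spread_id st)) (spread_evens _ _).
    exact: (congr2 *%R e1 (big_tnth _ _ _ _ _)).
case=> s [a [m [c [eta [sm gd hc bc ->]]]]].
have [k kP] : {k : 'I_m -> atom G & forall i, normal q (k i) /\ c i = atom_val X q (k i)}.
  apply: (@choice _ _ (fun i k => normal q k /\ c i = atom_val X q k)) => i.
  by have /basis_factorP[k nk ck] := bc i; exists k.
pose a' i := if insub i is Some j then a j else 0%N.
have aE (i : 'I_s) : a' i = a i by rewrite /a' valK.
pose l := [seq k i | i <- index_enum 'I_m].
exists (spread a' s), l; split.
- rewrite /standard spread_sorted; apply/reducedP => j; rewrite spread_count /small.
  case: (ltnP j s) => [lt|_]; last by case: (q).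
  rewrite -[j]/(val (Ordinal lt)) aE; case q0: (q == 0)%N => //=.
  by apply: sm; move: fq q0; case: (q).
- by apply/allP => _ /mapP[i _ ->]; have [] := kP i.
- suff -> : degs l = eta by [].
  rewrite -map_comp (eq_map (_ : _ =1 tnth eta)).
    by rewrite /index_enum locked_withE -enumT map_tnth_enum.
  move=> i /=; have [nk ck] := kP i.
  apply: homog_uniq (atom_neq0 nk) (@homog_atom F G q _) _.
  by rewrite -ck.
- rewrite spread_evens /atoms_val big_map; congr (_ * _).
    by apply: eq_bigr => i _; rewrite aE.
  by apply: eq_bigr => i _; have [_ ->] := kP i.
Qed.

(** By induction on the number of commutators: the products with fewer
    commutators than a given one have zero coefficients, and the walk of its
    degrees kills those with more commutators or with other degrees. What
    remains is a combination of independent functions. *)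
Lemma basis_products_free (s : seq A) (a : A -> F) : uniq s ->
  (forall f, f \in s -> basis_product eps f) ->
  \sum_(f <- s) a f *: f \in (IdG eps : pred A) -> forall f, f \in s -> a f = 0.
Proof.
move=> us bs Is.
have [key keyP] : {key : A -> seq nat * seq (atom G) & forall f, f \in s ->
    [/\ standard q (key f).1, all (normal q) (key f).2, good eps F (degs (key f).2)
      & f = evens_val X (key f).1 * atoms_val X q (key f).2]}.
  apply: (@choice _ _ (fun f ml => f \in s -> [/\ standard q ml.1, all (normal q) ml.2,
    good eps F (degs ml.2) & f = evens_val X ml.1 * atoms_val X q ml.2])) => f.
  have [/bs/basis_productP[m [l ml]]|_] := boolP (f \in s).
    by exists (m, l).
  by exists ([::], [::]).
have key_inj f f' : f \in s -> f' \in s -> key f = key f' -> f = f'.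
  by move=> /keyP[_ _ _ {2}->] /keyP[_ _ _ {2}->] ->.
suff main n : forall f, f \in s -> size (key f).2 = n -> a f = 0.
  by move=> f fs; apply: main fs erefl.
elim/ltn_ind: n => n IH f0 f0s sz; have [_ _ /goodP[i [t w]] _] := keyP f0 f0s.
pose eta := degs (key f0).2; pose L := [seq (a f, key f) | f <- s & degs (key f).2 == eta].
have szt : size t = n.
  by case: w => _ /(congr1 size); rewrite size_pairmap size_map sz.
have ind := independent_prod (independent_monomials fq) (independent_atoms_seq fq (eta := eta)).
have := ind L.
rewrite all_map => /(_ _ _ (key f0)); rewrite big_map big_filter_cond => ind0.
transitivity (\sum_(f <- s | (degs (key f).2 == eta) && (key f == key f0)) a f).
  rewrite [RHS]big_mkcond (bigD1_seq f0) //= /eta !eqxx /= big_seq_cond.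
  rewrite big1 ?addr0 // => f /andP[fs ne]; case: ifP => // /andP[_ /eqP e].
  by case/eqP: ne; apply: key_inj.
apply: ind0 => [|[d0 v]].
  apply/allP => f; rewrite mem_filter => /andP[/= -> /keyP[-> -> _ _]].
  by [].
rewrite big_map big_filter.
have vanish := identity_mx (chain_increasing w) (@chain_mx_homog F G eps eta i t w d0 v) Is.
have := congr1 (fun M : 'M[F]_((size t).+1) => M ord0 ord_max) vanish.
have entryD (h : A -> F) (r : seq A) : all (fun f => f \in s) r ->
    (forall f, f \in s -> a f * fmorph (chain_mx eta t d0 v) f ord0 ord_max = h f) ->
    fmorph (chain_mx eta t d0 v) (\sum_(f <- r) a f *: f)
      ord0 ord_max = \sum_(f <- r) h f.
  move=> rs hh; elim: r rs => [_|f r IHr /= /andP[fs rs]].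
    by rewrite !big_nil (raddf0 (fmorph _)) mxE.
  rewrite !big_cons fmorph_is_linear mxE IHr // -hh //; congr (_ + _).
  by rewrite mxE.
rewrite (entryD (fun f => if degs (key f).2 == eta then
    a f * (monomial (key f).1 d0 * atoms_fun q (key f).2 v) else 0)) ?mxE.
- by rewrite -big_mkcond => ->.
- exact/allP.
move=> f fs; have [_ nl _ fE] := keyP f fs.
have [lt|le] := ltnP (size (key f).2) n.
  by rewrite (IH _ lt f fs erefl) !mul0r; case: ifP.
have := chain_evaluation fq w d0 v (key f).1 (normal_valid nl).
rewrite -fE => -> //; last by rewrite szt.
by case: ifP => // _; rewrite mulr0.
Qed.

End BasisProducts.

(** * Generators and basis *)

Section Generation.
Variables (F : fieldType) (G : groupType) (eps : nat -> G).
Local Notation A := (freeAlg F G).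
Local Notation T := (graded_ideal_generated (@bad_product F G eps)).

Lemma graded_ideal_linear (I : A -> Prop) a f h : graded_ideal I ->
  I f -> I h -> I (a *: f + h).
Proof.
move=> [[_ ID IM] _] If Ih; apply: (ID) => //.
by have := IM f (a *: 1) 1 If; rewrite mulr1 -scalerAl mul1r.
Qed.

Lemma generated_IdG f : T f -> f \in (IdG eps : pred A).
Proof.
move=> Tf; apply: (Tf (fun f => f \in IdG eps)); first exact: IdG_graded_ideal.
exact: bad_product_identity.
Qed.

(** Straightening yields products of both kinds; the bad ones are
    consequences of the generators. *)
Lemma good_span_decomposition (f : A) :
  exists2 g, span (basis_product eps) g & T (f - g).
Proof.
have [q fq] := field_size_exists F.
have lin (u : A) : span (straight_product (@genx F G) q) u ->
    exists2 g, span (basis_product eps) g & T (u - g).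
  elim=> [|a v w [m [l [st red nl ->]]] _ [g Sg Tg]].
    by exists 0; [exact: span0 | move=> I [[I0 _ _] _] _; rewrite subr0].
  have [gd|bad] := EM (good eps F (map (fun c : atom G => head_deg c.1) l)).
    exists (a *: (evens_val (@genx F G) m * atoms_val (@genx F G) q l) + g).
      apply: span_cons Sg; apply/(basis_productP eps fq); exists m, l; split=> //.
      by rewrite /standard st red.
    by rewrite opprD addrACA subrr add0r.
  exists g => //; rewrite -addrA => I gI Ibad.
  apply: (graded_ideal_linear _ gI _ (Tg I gI Ibad)).
  have [[_ _ IM] _] := gI; rewrite -[_ * _]mulr1; apply: IM.
  exact: (bad_atoms_ideal fq gI Ibad (normal_valid nl)).
apply: lin; rewrite (malg_expand f).
elim: (enum_fset (msupp f)) => [|w s IH]; first by rewrite big_nil; apply: span0.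
rewrite big_cons; apply: spanDZ IH.
rewrite -[<< w >>]/(monom F w) monom_xvar.
exact: (word_straight (@genx F G) fq).
Qed.

Lemma span_uniq_sum (V : lmodType F) (S : V -> Prop) u : span S u ->
  exists (s : seq V) (a : V -> F),
    [/\ uniq s, forall v, v \in s -> S v & u = \sum_(v <- s) a v *: v].
Proof.
elim=> [|a v w Sv _ [s [b [us Ss ->]]]].
  by exists [::], (fun=> 0); rewrite big_nil.
have [vs|vs] := boolP (v \in s).
  exists s, (fun z => b z + (z == v)%:R * a); split=> //.
  rewrite (bigD1_seq v) //= [RHS](bigD1_seq v) //= eqxx mul1r addrA -scalerDl.
  congr (_ *: _ + _); first exact: addrC.
  by apply: eq_bigr => z /negPf ->; rewrite mul0r addr0.
exists (v :: s), (fun z => if z == v then a else b z); split; first by rewrite /= vs.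
  by move=> z; rewrite inE => /predU1P[->|/Ss].
rewrite big_cons eqxx; congr (_ + _); rewrite !big_seq; apply: eq_bigr => z zs.
by case: eqP => // zv; rewrite -zv zs in vs.
Qed.

Lemma relFree_pi0 : relFree_pi eps (0 : A) = 0.
Proof.
have := relFree_scale_pi eps 0 (0 : A); rewrite scaler0 => <-.
exact: (scale0r (relFree_pi eps (0 : A))).
Qed.

Lemma relFree_pi_sum (s : seq A) (a : A -> F) :
  relFree_pi eps (\sum_(f <- s) a f *: f) = \sum_(f <- s) a f *: relFree_pi eps f.
Proof.
elim: s => [|f s IH]; first by rewrite !big_nil relFree_pi0.
rewrite [in LHS]big_cons [RHS]big_cons.
apply: etrans (relFree_piD _ _ _) _.
exact: (congr2 +%R (esym (relFree_scale_pi eps (a f) f)) IH).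
Qed.

Lemma relFree_pi_eq0 f : relFree_pi eps f = 0 <-> f \in (IdG eps : pred A).
Proof. by rewrite -relFree_pi0 relFree_piP subr0. Qed.

End Generation.

Theorem theorem3p22 (F : fieldType) (G : groupType) (eps : nat -> G) :
  (forall f : freeAlg F G,
     f \in IdG eps <-> graded_ideal_generated (bad_product eps) f) /\
  is_basis (basis_product eps) (@relFree_pi F G eps).
Proof.
have [q fq] := field_size_exists F.
split=> [f|].
  split=> [If|]; last exact: generated_IdG.
  have [g Sg Tfg] := good_span_decomposition eps f.
  have Ig : g \in (IdG eps : pred (freeAlg F G)).
    have := IdG_linear (-1) (generated_IdG Tfg) If.
    by rewrite scaleN1r opprB subrK.
  suff g0 : g = 0 by rewrite -[f]subr0 -g0.
  have [s [a [us bs eg]]] := span_uniq_sum Sg; rewrite eg in Ig.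
  rewrite eg big_seq big1 // => h hs.
  by rewrite (basis_products_free fq us bs Ig hs) scale0r.
split=> [s a us bs e|x].
  by apply: (basis_products_free fq us bs); apply/relFree_pi_eq0; rewrite relFree_pi_sum.
have [g Sg Tfg] := good_span_decomposition eps (repr x).
have [s [a [us bs eg]]] := span_uniq_sum Sg; exists s, a; split=> //.
rewrite -relFree_pi_sum -eg -[x in LHS]reprK -/(relFree_pi eps (repr x)).
exact/relFree_piP/generated_IdG.
Qed.
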